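(* Consider the weight vector $L=(1,\ldots,1)$ in $\mathbb{P}^n$ (that is, $l_i=1$ for every $i=0,\ldots,n-2$). Then $L$ is feasible for $n\leq 5$ and non-feasible for $n\geq 8$.
   Context: Work over $\mathbb{C}$, with $n\ge 2$. A weight vector in $\mathbb{P}^n$ is a vector of non-negative integers $L=(l_0,\ldots,l_{n-2})$. A configuration of linear spaces of weight $L$ is a union of $l_i$ linear spaces of dimension $i$ in $\mathbb{P}^n$, for $i=0,\ldots,n-2$; it is generic if the tuple of its linear components is chosen in a suitable non-empty Zariski open subset of the corresponding product of Grassmannians. A configuration $\Lambda_1\cup\dots\cup\Lambda_t$ is feasible if there is a rational normal curve $\mathcal{C}\subset\mathbb{P}^n$ (a curve projectively equivalent to the degree $n$ Veronese embedding of $\mathbb{P}^1$) such that the scheme $\mathcal{C}\cap\Lambda_i$ has degree $\dim\Lambda_i+1$ for every component $\Lambda_i$. The weight vector $L$ is feasible if a generic configuration of weight $L$ is feasible, and non-feasible otherwise. *)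

(* Defs.v *)
From mathcomp Require Import all_boot all_order all_algebra.
From mathcomp Require Import classical_sets reals.
From mathcomp Require Import complex mpoly.

Set Implicit Arguments.
Unset Strict Implicit.
Unset Printing Implicit Defensive.

Import GRing.Theory.
Local Open Scope classical_set_scope.
Local Open Scope ring_scope.

(* Points of P^n are nonzero row vectors of length n.+1 up to scalars.  A subset
   of P^n is represented by its affine cone, a set of row vectors. *)

Section RationalNormalCurves.
Variables (K : closedFieldType) (n : nat).

Definition veronese (s t : K) : 'rV[K]_n.+1 :=
  \row_(i < n.+1) (s ^+ (n - i) * t ^+ i).

Definition veronese_cone : set 'rV[K]_n.+1 :=
  [set v | exists c s t : K, v = c *: veronese s t].

Definition rational_normal_curve (X : set 'rV[K]_n.+1) : Prop :=
  exists2 g : 'M[K]_n.+1, g \in unitmx & X = [set v *m g | v in veronese_cone].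

End RationalNormalCurves.

Section IntersectionDegree.
Variables (K : closedFieldType) (n : nat).

Definition homog_ideal (X : set 'rV[K]_n.+1) (d : nat) :
    set (dhomog n.+1 K d) :=
  [set p | forall v, X v -> (mpoly_of_dhomog p).@[v ord0] = 0].

(* The scheme-theoretic intersection of X and Y is Proj (S / (I_X + I_Y)), where
   S is the homogeneous coordinate ring of P^n; it is zero-dimensional (or empty)
   of degree m iff dim (S / (I_X + I_Y))_d = m for all large d.  Below,
   W = (I_X + I_Y)_d, which is the sum of (I_X)_d and (I_Y)_d. *)
Definition intersection_degree (X Y : set 'rV[K]_n.+1) (m : nat) : Prop :=
  exists d0 : nat, forall d : nat, (d0 <= d)%N ->
    exists W : {vspace dhomog n.+1 K d},
      (forall p, p \in W <->
         exists q r, [/\ homog_ideal X q, homog_ideal Y r & p = q + r])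
      /\ \dim {:dhomog n.+1 K d} = (\dim W + m)%N.

End IntersectionDegree.

Section Configurations.
Variables (K : closedFieldType) (n : nat).

(* The Grassmannian of k-dimensional linear spaces in P^n, i.e. of vector
   subspaces of K^(n+1) of dimension k.+1. *)
Definition linear_space (k : nat) :=
  {V : {vspace 'rV[K]_n.+1} | \dim V == k.+1}.

Definition linear_cone k (V : linear_space k) : set 'rV[K]_n.+1 :=
  [set v | v \in val V].

(* (l_0, ..., l_{n-2}); the index type is as intended for n >= 1. *)
Definition weight_vector := 'I_n.-1 -> nat.

Variable L : weight_vector.

(* The j-th component of dimension i is indexed by the pair (i, j). *)
Definition component := {i : 'I_n.-1 & 'I_(L i)}.

Definition component_dim (c : component) : nat := tag c.

Definition configuration := forall c : component, linear_space (component_dim c).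

(* A frame of a configuration: for each component, a matrix whose rows form a
   basis of the corresponding vector subspace. *)
Definition frame := forall c : component, 'M[K]_((component_dim c).+1, n.+1).

Definition frame_of (A : frame) (La : configuration) : Prop :=
  forall c, val (La c) = <<[seq row i (A c) | i : 'I_(component_dim c).+1]>>%VS.

Definition frame_index :=
  {c : component & ('I_(component_dim c).+1 * 'I_n.+1)%type}.

Definition frame_entries (A : frame) (k : 'I_#|{: frame_index}|) : K :=
  let x := enum_val k in A (tag x) (tagged x).1 (tagged x).2.

(* The Zariski topology on the product of Grassmannians, as the quotient of the
   Zariski topology on the variety of frames (an open subset of an affine space)
   by the product of the groups GL_{k+1}: U is open iff its inverse image
   in the variety of frames is the locus where some member of a set F of
   polynomials in the matrix entries does not vanish. *)
Definition zariski_open (U : set configuration) : Prop :=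
  exists F : set {mpoly K[#|{: frame_index}|]},
    forall (A : frame) (La : configuration), frame_of A La ->
      (U La <-> exists2 f, F f & f.@[frame_entries A] != 0).

Definition generic (P : configuration -> Prop) : Prop :=
  exists U : set configuration,
    [/\ zariski_open U, U !=set0 & forall La, U La -> P La].

Definition feasible_configuration (La : configuration) : Prop :=
  exists2 X : set 'rV[K]_n.+1, rational_normal_curve X &
    forall c, intersection_degree X (linear_cone (La c)) (component_dim c).+1.

Definition feasible : Prop := generic feasible_configuration.

Definition non_feasible : Prop := ~ feasible.

End Configurations.

(* Main.v *)
From HB Require Import structures.
Require Import Defs.
From mathcomp Require Import all_boot all_order all_algebra.
From mathcomp Require Import reals complex.
From mathcomp Require Import classical_sets mpoly qpoly zify.

(* Restricting forms of degree [d] to the rational normal curve identifies the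
   homogeneous coordinate ring of the curve, in degree [d], with the polynomials
   in [t] of degree at most [n d].  The linear forms vanishing on a space [V]
   restrict to polynomials whose gcd [q] defines the intersection scheme; if [V]
   misses the point at infinity, the intersection has degree [deg q].

   For [n >= 8], an [i]-space meeting the curve in degree [i + 1] consists of the
   linear recurrent sequences with characteristic polynomial [q], in the
   coordinates of the curve.  So the frames of feasible configurations are
   parametrized by [(n+1)^2] entries of a matrix [g], and for every component by
   [i + 1] coefficients of [q] and [(i+1)^2] entries of a change of basis.  For
   [n >= 8] these are fewer parameters than the entries of a frame, even without
   dividing by the automorphisms of the curve, so a non-zero polynomial vanishes
   on all these frames.

   For [n <= 5], configurations in general position form a single orbit of
   [GL_(n+1)], as shown by a normal form, and this orbit contains configurations
   of secant spaces spanned by distinct points of the standard curve.  For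
   [n = 5], with components [p], [l], [pi], [sg], one uses [p + l + pi = P^5] and
   the induced maps of [p], [l], [pi] to the quotient by [sg], which is
   isomorphic to [l]. *)

Set Implicit Arguments.
Unset Strict Implicit.
Unset Printing Implicit Defensive.

Import GRing.Theory.
Local Open Scope ring_scope.

(** * Restriction of forms to a rational normal curve *)


Section PolynomialVanishing.
Variable K : closedFieldType.

Lemma poly_eq0_horner (p : {poly K}) : (forall x, p.[x] = 0) -> p = 0.
Proof.
move=> p0; apply/eqP/negbNE/negP => /closed_nonrootP[x].
by rewrite /root p0 eqxx.
Qed.

Lemma horner_mmap m (h : 'I_m -> {poly K}) (p : {mpoly K[m]}) x :
  (mmap polyC h p).[x] = p.@[fun j => (h j).[x]].
Proof.
rewrite mevalE /mmap horner_sum; apply: eq_bigr => u _.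
rewrite hornerM hornerC; congr (_ * _).
by rewrite /mmap1 horner_prod; apply: eq_bigr => i _; rewrite horner_exp.
Qed.

Lemma size_mmap_homog m (h : 'I_m -> {poly K}) b d (p : {mpoly K[m]}) :
  (forall j, size (h j) <= b.+1)%N -> p \is d.-homog ->
  (size (mmap polyC h p) <= (b * d).+1)%N.
Proof.
move=> hb /dhomogP hp; rewrite /mmap big_seq.
apply: (leq_trans (size_sum _ _ _)); apply/bigmax_leqP_seq => u _ up.
rewrite mul_polyC; apply: (leq_trans (size_scale_leq _ _)).
have <- : mdeg u = d by apply: hp.
rewrite mdegE /mmap1.
elim/big_ind2: _ => [||i _]; first by rewrite size_poly1.
  move=> q1 d1 q2 d2 h1 h2; rewrite mulnDr.
  apply: (leq_trans (size_polyMleq _ _)); lia.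
elim: (u i) => [|k IH]; first by rewrite expr0 size_poly1.
rewrite exprS; apply: (leq_trans (size_polyMleq _ _)).
by move: (size _) (size _) IH (hb i) => x y; rewrite mulnS; lia.
Qed.

Lemma meval_homogZ m d (p : {mpoly K[m]}) c (v : 'I_m -> K) :
  p \is d.-homog -> p.@[fun j => c * v j] = c ^+ d * p.@[v].
Proof.
move=> /dhomogP hp; rewrite !mevalE mulr_sumr !big_seq.
apply: eq_bigr => u up; rewrite mulrCA; congr (_ * _).
have <- : mdeg u = d by apply: hp.
rewrite mdegE -prodrXr -big_split /=.
by apply: eq_bigr => i _; rewrite exprMn.
Qed.

End PolynomialVanishing.

Section LinearForms.
Variables (K : fieldType) (n : nat).

(** In the chart [s = 1], the linear form with coefficient column [c] takes this value, as a
    polynomial in [t], at the points of the standard curve. *)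
Definition col_poly (c : 'cV[K]_n) : {poly K} := rVpoly c^T.

Lemma coef_col_poly c (i : 'I_n) : (col_poly c)`_i = c i ord0.
Proof. by rewrite coef_rVpoly_ord mxE. Qed.

Lemma size_col_poly c : (size (col_poly c) <= n)%N.
Proof. exact: size_poly. Qed.

Lemma col_polyE c : col_poly c = \sum_(i < n) c i ord0 *: 'X^i.
Proof.
rewrite /col_poly /rVpoly poly_def; apply: eq_bigr => i _.
by rewrite insubT //= => lt_i; rewrite mxE; congr (c _ _ *: _); apply: val_inj.
Qed.

Lemma col_polyK (f : {poly K}) :
  (size f <= n)%N -> col_poly (\col_i f`_i) = f.
Proof.
move=> sf; rewrite -[RHS](poly_rV_K sf); congr rVpoly.
by apply/rowP => i; rewrite !mxE.
Qed.

Lemma col_poly_inj : injective col_poly.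
Proof.
move=> c1 c2 e; apply/matrixP => i j.
by rewrite ord1 -!coef_col_poly e.
Qed.

Definition lin_form (c : 'cV[K]_n) : {mpoly K[n]} := \sum_j c j ord0 *: 'X_j.

Lemma lin_form_homog c : lin_form c \is 1.-homog.
Proof.
by apply: rpred_sum => j _; apply: rpredZ; rewrite dhomogX /= mdeg1.
Qed.

Lemma meval_lin_form c (v : 'rV[K]_n) : (lin_form c).@[v ord0] = (v *m c) ord0 ord0.
Proof.
rewrite /lin_form raddf_sum mxE; apply: eq_bigr => j _.
by rewrite /= mevalZ mevalXU mulrC.
Qed.

End LinearForms.

Section CurveRestriction.
Variables (K : closedFieldType) (n : nat) (g : 'M[K]_n.+1).

(** Pull-back along [t |-> veronese n 1 t *m g]. The remaining point of the curve, at infinity, is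
    [row ord_max g]; vanishing there shows as a drop in degree. *)
Definition curve_restr : {mpoly K[n.+1]} -> {poly K} :=
  mmap polyC (fun j => col_poly (col j g)).

Lemma curve_restrM : {morph curve_restr : p q / p * q}.
Proof. by move=> p q; rewrite /curve_restr rmorphM. Qed.

Lemma curve_restrD : {morph curve_restr : p q / p + q}.
Proof. by move=> p q; rewrite /curve_restr raddfD. Qed.

Lemma curve_restr_sum I (r : seq I) (F : I -> {mpoly K[n.+1]}) :
  curve_restr (\sum_(i <- r) F i) = \sum_(i <- r) curve_restr (F i).
Proof. by rewrite /curve_restr raddf_sum. Qed.

Lemma curve_restrZ a p : curve_restr (a *: p) = a *: curve_restr p.
Proof. by rewrite /curve_restr mmapZ mul_polyC. Qed.

Definition curve : set 'rV[K]_n.+1 :=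
  [set v *m g | v in @veronese_cone K n].

Lemma horner_curve_restr p t :
  (curve_restr p).[t] = p.@[(veronese n 1 t *m g) ord0].
Proof.
rewrite horner_mmap; apply: meval_eq => j.
rewrite col_polyE horner_sum mxE; apply: eq_bigr => i _.
by rewrite hornerZ hornerXn !mxE expr1n mul1r mulrC.
Qed.

Lemma size_curve_restr d p :
  p \is d.-homog -> (size (curve_restr p) <= (n * d).+1)%N.
Proof. by apply: size_mmap_homog => j; exact: size_col_poly. Qed.

Lemma curve_restr_lin_form c : curve_restr (lin_form c) = col_poly (g *m c).
Proof.
rewrite /curve_restr /lin_form raddf_sum /= col_polyE.
under eq_bigr do rewrite mmapZ mmapX mmap1U col_polyE mul_polyC scaler_sumr.
rewrite exchange_big; apply: eq_bigr => i _ /=.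
rewrite mxE scaler_suml; apply: eq_bigr => j _.
by rewrite mxE scalerA mulrC.
Qed.

Lemma homog_ideal_curve d (p : dhomog n.+1 K d) :
  @homog_ideal K n curve d p <-> curve_restr p = 0.
Proof.
have hp : (p : {mpoly K[n.+1]}) \is d.-homog by apply: dhomog_is_dhomog.
split=> [Hp|p0 _ [_ [c [s [t ->]]] <-]].
  apply: poly_eq0_horner => t; rewrite horner_curve_restr; apply: Hp.
  by exists (veronese n 1 t) => //; exists 1, 1, t; rewrite scale1r.
have scal b (w : 'rV[K]_n.+1) :
    (mpoly_of_dhomog p).@[(b *: w *m g) ord0] =
    b ^+ d * (mpoly_of_dhomog p).@[(w *m g) ord0].
  rewrite -(meval_homogZ _ _ hp); apply: meval_eq => j.
  by rewrite -scalemxAl mxE.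
rewrite scal.
(* For fixed [t], [Q] is [p] along [veronese n u t *m g] as a polynomial in [u]. It vanishes for
   [u != 0] by homogeneity, and the factor ['X] takes care of [u = 0]; hence [Q = 0], which covers
   the point at infinity. *)
pose Q := mmap polyC (fun j => \sum_i (g i j * t ^+ i) *: 'X^(n - i))
  (p : {mpoly K[n.+1]}).
have QE u : Q.[u] = (mpoly_of_dhomog p).@[(veronese n u t *m g) ord0].
  rewrite horner_mmap; apply: meval_eq => j.
  rewrite horner_sum mxE; apply: eq_bigr => i _.
  by rewrite hornerZ hornerXn !mxE -mulrA mulrC [t ^+ _ * _]mulrC.
have: Q * 'X = 0.
  apply: poly_eq0_horner => u; rewrite hornerM hornerX QE.
  have [->|u0] := eqVneq u 0; first by rewrite mulr0.
  have -> : veronese n u t = u ^+ n *: veronese n 1 (t / u).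
    apply/rowP => i; rewrite !mxE expr1n mul1r expr_div_n mulrCA mulrC.
    congr (_ * _); have := exprD u (n - i) i.
    by rewrite subnK ?leq_ord // => ->; rewrite mulfK // expf_neq0.
  by rewrite scal -horner_curve_restr p0 horner0 mulr0 mul0r.
move/eqP; rewrite mulf_eq0 polyX_eq0 orbF => /eqP Q0.
by rewrite -QE Q0 horner0 mulr0.
Qed.

Hypothesis gU : g \in unitmx.

(** Projective normality of the rational normal curve: ['X^k] with [k <= n * d] is a product of [d]
    restricted linear forms, splitting off ['X^(minn k n)] each time. *)
Lemma curve_restr_surj d (f : {poly K}) : (size f <= (n * d).+1)%N ->
  exists p : dhomog n.+1 K d, curve_restr p = f.
Proof.
have mono k : (k <= n * d)%N ->
    exists2 p : {mpoly K[n.+1]}, (p \is d.-homog) & curve_restr p = 'X^k.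
  elim: d k => [|d IH] k.
    rewrite muln0 leqn0 => /eqP ->; exists 1; first exact: dhomog1.
    by rewrite /curve_restr rmorph1 expr0.
  rewrite mulnS => le_k.
  have [|q hq eq_q] := IH (k - n)%N; first lia.
  pose c : 'cV[K]_n.+1 := \col_i ('X^(minn k n))`_i.
  exists (lin_form (invmx g *m c) * q).
    by rewrite -(add1n d); apply: dhomogM => //; apply: lin_form_homog.
  rewrite curve_restrM curve_restr_lin_form.
  rewrite mulKVmx // col_polyK ?size_polyXn ?ltnS ?geq_minr // eq_q.
  by rewrite -exprD; congr ('X^ _); lia.
move=> sf.
suff [p hp <-] : exists2 p : {mpoly K[n.+1]}, (p \is d.-homog) & curve_restr p = f.
  by exists (DHomog hp).
have -> : f = \sum_(k < (n * d).+1) f`_k *: 'X^k.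
  by rewrite -poly_def; apply/polyP => i; rewrite coef_poly;
     case: ltnP => // le_i; rewrite nth_default // (leq_trans sf).
have {}mono (k : 'I_(n * d).+1) :
    exists p : dhomog n.+1 K d, curve_restr p = 'X^k.
  by have [|p hp <-] := mono k; [rewrite -ltnS | exists (DHomog hp)].
have [p pE] := fin_all_exists mono.
exists (\sum_(k < (n * d).+1) f`_k *: (p k : {mpoly K[n.+1]})).
  by apply: rpred_sum => k _; apply: rpredZ; apply: dhomog_is_dhomog.
by rewrite curve_restr_sum; apply: eq_bigr => k _; rewrite curve_restrZ pE.
Qed.

End CurveRestriction.

(** * Intersection of the curve with a linear space *)


Section IntersectionWithCurve.
Variables (K : closedFieldType) (n : nat) (g : 'M[K]_n.+1).
Hypothesis gU : g \in unitmx.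
Variable V : {vspace 'rV[K]_n.+1}.

Local Notation cone := ([set v | v \in V]%classic : set 'rV[K]_n.+1).

Definition annihilates (c : 'cV[K]_n.+1) := forall v, v \in V -> v *m c = 0.

(** The restrictions to the curve of the linear forms vanishing on [V]. *)
Definition ann_poly (u : {poly K}) : Prop :=
  exists2 c, annihilates c & u = col_poly (g *m c).

Lemma size_ann_poly u : ann_poly u -> (size u <= n.+1)%N.
Proof. by case=> c _ ->; apply: size_col_poly. Qed.

Lemma curve_restr_cone_ann_mul d (u b : {poly K}) :
  ann_poly u -> (size b <= (n * d).+1)%N ->
  exists2 y : dhomog n.+1 K d.+1, homog_ideal cone y & curve_restr g y = u * b.
Proof.
move=> [c hc ->] /(curve_restr_surj gU)[p pE].
have hy : lin_form c * p \is d.+1.-homog.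
  rewrite -(add1n d); apply: dhomogM; first exact: lin_form_homog.
  exact: dhomog_is_dhomog.
exists (DHomog hy) => [v /= Vv|/=].
  by rewrite mevalM meval_lin_form hc // mxE mul0r.
by rewrite curve_restrM curve_restr_lin_form pE.
Qed.

(** The coefficients [a j * r] may be too large to come from forms of degree [d - 1]. They are
    therefore reduced modulo [u0], of exact degree [n], and the quotients are collected in one
    multiple [u0 * c]. The reduced products have degree less than [2 n], which fits since [1 < d];
    comparing degrees then bounds [c]. *)
Lemma curve_restr_cone_ideal_mul d k (u a : 'I_k -> {poly K}) (u0 r : {poly K}) :
  (1 < d)%N -> ann_poly u0 -> size u0 = n.+1 -> (forall j, ann_poly (u j)) ->
  (size ((\sum_j a j * u j) * r)%R <= (n * d).+1)%N ->
  exists2 y : dhomog n.+1 K d,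
    homog_ideal cone y & curve_restr g y = (\sum_j a j * u j) * r.
Proof.
case: d => // d d_gt0 hu0 su0 hu.
set f := _ * r => sf.
have u00 : u0 != 0 by rewrite -size_poly_gt0 su0.
pose c := \sum_j ((a j * r) %/ u0) * u j.
pose b j := (a j * r) %% u0.
have sb j : (size (b j) <= n)%N.
  by rewrite -ltnS -su0 ltn_modp.
have fE : f = \sum_j u j * b j + u0 * c.
  rewrite /f mulr_suml /c mulr_sumr -big_split; apply: eq_bigr => j _ /=.
  rewrite mulrAC {1}(divp_eq (a j * r) u0) /b mulrDl addrC.
  by rewrite mulrA [u0 * _]mulrC [u j * _]mulrC.
have sc : (size c <= (n * d).+1)%N.
  have [->|c0] := eqVneq c 0; first by rewrite size_poly0.
  have : (size (u0 * c)%R <= (n * d.+1).+1)%N.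
    have -> : u0 * c = f - \sum_j u j * b j by rewrite fE addrC addKr.
    apply: (leq_trans (size_polyD _ _)); rewrite geq_max sf size_polyN.
    apply: (leq_trans (size_sum _ _ _)); apply/bigmax_leqP => j _.
    apply: (leq_trans (size_polyMleq _ _)).
    move: (size_ann_poly (hu j)) (sb j); rewrite mulnS.
    move: (size _) (size _) => x y; nia.
  rewrite size_mul // su0 mulnS; move: (size c) => x; lia.
have [y0 hy0 y0E] := curve_restr_cone_ann_mul hu0 sc.
have /fin_all_exists[y hy] j : exists y : dhomog n.+1 K d.+1,
    homog_ideal cone y /\ curve_restr g y = u j * b j.
  have [|y ? ?] := @curve_restr_cone_ann_mul d _ (b j) (hu j); last by exists y.
  move: (size (b j)) (sb j) => x; nia.
have hs : \sum_j (y j : {mpoly K[n.+1]}) + y0 \is d.+1.-homog.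
  apply: rpredD; last exact: dhomog_is_dhomog.
  by apply: rpred_sum => j _; apply: dhomog_is_dhomog.
exists (DHomog hs) => [v Vv /=|/=].
  rewrite mevalD hy0 // addr0 raddf_sum big1 // => j _.
  by have [/(_ v Vv)] := hy j.
rewrite curve_restrD curve_restr_sum y0E fE.
by congr (_ + _); apply: eq_bigr => j _; have [] := hy j.
Qed.

Lemma leq_pred_add a b N : (a.-1 <= N)%N -> (0 < a)%N ->
  ((a + b).-1 <= N)%N = (b <= N - a.-1)%N.
Proof. lia. Qed.

(** * Multiples of a polynomial in bounded degree *)

Section Multiples.
Variables (q : {poly K}) (N : nat).

Definition mul_npoly (r : {poly_(N - (size q).-1) K}) : {poly_N K} :=
  npolyp N (q * r).

Fact mul_npoly_linear : linear mul_npoly.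
Proof.
move=> a r s; apply/npolyP => i; rewrite /= coefD coefZ !coef_npolyp.
case: ltnP => _; last by rewrite mulr0 addr0.
by rewrite /= mulrDr coefD -scalerAr coefZ.
Qed.
HB.instance Definition _ := GRing.isLinear.Build K _ _ _ mul_npoly
  mul_npoly_linear.

Definition multiples := limg (linfun mul_npoly).

Hypotheses (q0 : q != 0) (qN : ((size q).-1 <= N)%N).

Lemma size_mul_npoly (r : {poly_(N - (size q).-1) K}) :
  (size (q * r)%R <= N)%N.
Proof.
have [->|r0] := eqVneq (polyn r) 0; first by rewrite mulr0 size_poly0.
rewrite size_mul // leq_pred_add ?size_poly_gt0 //; exact: size_npoly.
Qed.

Lemma dim_multiples : \dim multiples = (N - (size q).-1)%N.
Proof.
rewrite limg_dim_eq ?dim_polyn //; apply/eqP; rewrite -subv0.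
apply/subvP => r; rewrite memv_cap memvf andTb memv_ker lfunE memv0 /=.
move/eqP/(congr1 (@polyn _ _)); rewrite npolypK ?size_mul_npoly // => /eqP.
by rewrite mulf_eq0 (negPf q0) => /eqP r0; apply/eqP/val_inj.
Qed.

Lemma multiplesP (f : {poly_N K}) : (f \in multiples) = (q %| f).
Proof.
apply/memv_imgP/idP => [[r _ ->]|/dvdpP[r fE]].
  by rewrite lfunE /= npolypK ?size_mul_npoly // dvdp_mulr.
have sr : (size r <= N - (size q).-1)%N.
  have [->|r0] := eqVneq r 0; first by rewrite size_poly0.
  have := size_npoly f; rewrite fE size_mul //.
  have := q0; rewrite -size_poly_gt0; move: (size r) (size q) => x y; lia.
exists (npolyp _ r); rewrite ?memvf // lfunE; apply: val_inj => /=.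
by rewrite /mul_npoly npolypK npolypK // mulrC -fE ?size_npoly.
Qed.

End Multiples.

Section Restriction.
Variable d : nat.

Definition restr_npoly (p : dhomog n.+1 K d) : {poly_(n * d).+1 K} :=
  npolyp _ (curve_restr g p).

Lemma restr_npolyE p : restr_npoly p = curve_restr g p :> {poly K}.
Proof. by rewrite npolypK // size_curve_restr // dhomog_is_dhomog. Qed.

Fact restr_npoly_linear : linear restr_npoly.
Proof.
move=> a r s; apply: val_inj; rewrite /= !restr_npolyE.
by rewrite /curve_restr raddfD /= mmapZ mul_polyC.
Qed.
HB.instance Definition _ := GRing.isLinear.Build K _ _ _ restr_npoly
  restr_npoly_linear.

Lemma limg_restr_npoly : limg (linfun restr_npoly) = fullv.
Proof.
apply/eqP; rewrite eqEsubv subvf; apply/subvP => f _.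
have [p pE] := curve_restr_surj gU (size_npoly f).
apply/memv_imgP; exists p; rewrite ?memvf // lfunE; apply: val_inj.
by rewrite /= restr_npolyE.
Qed.

Lemma mem_lker_restr_npoly p :
  p \in lker (linfun restr_npoly) <-> homog_ideal (curve g) p.
Proof.
rewrite homog_ideal_curve memv_ker lfunE -restr_npolyE; split=> [/eqP -> //|p0].
by apply/eqP/val_inj.
Qed.

(** The summand [(n * d).+1] is the Hilbert function of the rational normal curve. *)
Lemma dim_dhomog_restr :
  (\dim {: dhomog n.+1 K d} =
    \dim (lker (linfun restr_npoly)) + (n * d).+1)%N.
Proof.
have := limg_ker_dim (linfun restr_npoly) fullv.
by rewrite limg_restr_npoly capfv dim_polyn => <-.
Qed.

End Restriction.

(** Under the two divisibility hypotheses, the sum of the ideals in degree [d] is the preimage under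
    restriction of the multiples of [q], so its codimension is [deg q]. *)
Lemma intersection_degree_curve (q : {poly K}) :
  q != 0 -> (size q <= n.+1)%N ->
  (forall d y, @homog_ideal K n cone d y -> q %| curve_restr g y) ->
  (forall d r, (1 < d)%N -> (size (q * r)%R <= (n * d).+1)%N ->
    exists2 y : dhomog n.+1 K d,
      homog_ideal cone y & curve_restr g y = q * r) ->
  intersection_degree (curve g) cone (size q).-1.
Proof.
move=> q0 sq q_dvd q_mul; exists 2 => d d_gt1.
have qN : ((size q).-1 <= (n * d).+1)%N by nia.
pose M := multiples q (n * d).+1; pose P := linfun (@restr_npoly d).
exists (P @^-1: M)%VS; split=> [p|].
  rewrite -memv_preim lfunE multiplesP //= restr_npolyE; split=> [/dvdpP[r pE]|].
    have [|y hy yE] := q_mul d r d_gt1.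
      by rewrite mulrC -pE size_curve_restr // dhomog_is_dhomog.
    exists (p - y), y; split=> //; last by rewrite subrK.
    apply/homog_ideal_curve.
    by rewrite raddfB /= -scaleN1r curve_restrD curve_restrZ scaleN1r pE yE mulrC subrr.
  move=> [p1 [p2 [/homog_ideal_curve p1E /q_dvd q_p2 ->]]].
  by rewrite raddfD curve_restrD p1E add0r.
rewrite dim_dhomog_restr -(limg_ker_dim P (P @^-1: M)).
have /capv_idPr -> : (lker P <= P @^-1: M)%VS.
  by apply/subvP => p; rewrite memv_ker -memv_preim => /eqP ->; rewrite mem0v.
rewrite lpreimK ?limg_restr_npoly ?subvf // dim_multiples // -addnA subnK //.
Qed.

(** The sum of the ideals contains the kernel of the restriction, and its image contains all
    multiples of [q]; so its codimension [m] is at most [deg q]. *)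
Lemma intersection_degree_leq m (q : {poly K}) :
  intersection_degree (curve g) cone m ->
  (forall d r, (1 < d)%N -> (size (q * r)%R <= (n * d).+1)%N ->
    exists2 y : dhomog n.+1 K d,
      homog_ideal cone y & curve_restr g y = q * r) ->
  q != 0 -> (size q <= n.+1)%N -> (m <= (size q).-1)%N.
Proof.
move=> [d0 deg] q_mul q0 sq.
have [|W [memW]] := deg (maxn d0 2); first by rewrite leq_maxl.
set d := maxn d0 2.
have d_gt1 : (1 < d)%N by rewrite leq_maxr.
have qN : ((size q).-1 <= (n * d).+1)%N by nia.
rewrite dim_dhomog_restr -(limg_ker_dim (linfun (@restr_npoly d)) W).
have /capv_idPr -> : (lker (linfun (@restr_npoly d)) <= W)%VS.
  apply/subvP => p /mem_lker_restr_npoly hp; apply/memW.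
  exists p, 0; split=> //; last by rewrite addr0.
  by move=> v _; rewrite !raddf0.
have : (multiples q (n * d).+1 <= linfun (@restr_npoly d) @: W)%VS.
  apply/subvP => f; rewrite multiplesP // => /dvdpP[r fE].
  have [|y hy yE] := q_mul d r d_gt1; first by rewrite mulrC -fE size_npoly.
  apply/memv_imgP; exists y.
    apply/memW; exists 0, y; split=> //; last by rewrite add0r.
    by move=> v _; rewrite !raddf0.
  by rewrite lfunE; apply: val_inj; rewrite /= restr_npolyE yE fE mulrC.
move/dimvS; rewrite dim_multiples //; lia.
Qed.

End IntersectionWithCurve.

(** * Secant spaces *)


Section RowSpans.
Variables (K : fieldType) (n : nat).

Lemma mem_span_rows m (A : 'M[K]_(m, n)) v :
  (v \in <<[seq row i A | i : 'I_m]>>%VS) = (v <= A)%MS.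
Proof.
apply/idP/idP => [|/submxP[w ->]]; last first.
  rewrite mulmx_sum_row; apply: memv_suml => i _; apply: memvZ.
  by apply: memv_span; apply/mapP; exists i; rewrite ?mem_enum.
pose f := linfun (mulmxr (cokermx A) : 'rV_n -> 'rV_n).
suff sub : (<<[seq row i A | i : 'I_m]>> <= lker f)%VS.
  by move/(subvP sub); rewrite memv_ker lfunE /= submxE.
apply/span_subvP => _ /mapP[i _ ->].
by rewrite memv_ker lfunE /= -row_mul mulmx_coker row0.
Qed.

Lemma dim_span_row_free m (A : 'M[K]_(m, n)) :
  row_free A -> \dim <<[seq row i A | i : 'I_m]>> = m.
Proof.
move=> freeA; pose X := [tuple row i A | i < m].
have : free X.
  apply/freeP => k; under eq_bigr => j _ do rewrite -tnth_nth tnth_mktuple.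
  move=> k0 i; suff /rowP/(_ i) : \row_i k i = 0 by rewrite !mxE.
  apply: (row_free_inj freeA); rewrite mul0mx mulmx_sum_row -[RHS]k0.
  by apply: eq_bigr => j _; rewrite mxE.
by rewrite /free size_tuple => /eqP.
Qed.

Lemma dim_span_rows m (A : 'M[K]_(m, n)) :
  \dim <<[seq row i A | i : 'I_m]>> = \rank A.
Proof.
rewrite -(dim_span_row_free (row_base_free A)); congr (\dim _).
apply/eqP; rewrite eqEsubv; apply/andP; split; apply/subvP => v;
  by rewrite !mem_span_rows eq_row_base.
Qed.

Lemma span_rows_vbasis (V : {vspace 'rV[K]_n}) :
  V = <<[seq row i (\matrix_(i < \dim V) (vbasis V)`_i) | i : 'I_(\dim V)]>>%VS.
Proof.
rewrite -[LHS](span_basis (vbasisP V)); apply/eqP; rewrite eqEsubv.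
apply/andP; split; apply/span_subvP => v.
  case/(nthP 0) => i; rewrite size_tuple => lt_i <-; apply: memv_span.
  by apply/mapP; exists (Ordinal lt_i); rewrite ?mem_enum // rowK.
case/mapP => i _ ->; rewrite rowK; apply: memv_span.
by rewrite mem_nth ?size_tuple.
Qed.

End RowSpans.

Lemma col_mulmx (R : pzSemiRingType) m n p j (A : 'M[R]_(m, n))
  (B : 'M[R]_(n, p)) : col j (A *m B) = A *m col j B.
Proof. by apply/colP => i; rewrite !mxE; apply: eq_bigr => k _; rewrite mxE. Qed.

Lemma bezout_family (K : fieldType) k (u : 'I_k -> {poly K}) :
  exists q a, q = \sum_j a j * u j /\ forall j, q %| u j.
Proof.
elim: k u => [|k IH] u.
  by exists 0, (fun=> 0); split=> [|[]//]; rewrite big_ord0.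
have [q [a [qE q_dvd]]] := IH (fun j => u (lift ord0 j)).
have [[b1 b2] /= /eqpP[[c1 c2] /= /andP[c10 c20] bE]] := Bezoutp (u ord0) q.
(* The Bezout combination equals the gcd only up to a unit; [c1 / c2] corrects this. *)
pose b j := (c1 / c2) *:
  (if unlift ord0 j is Some j' then b2 * a j' else b1).
exists (gcdp (u ord0) q), b; split=> [|j].
  rewrite big_ord_recl /b unlift_none.
  under eq_bigr do rewrite liftK -scalerAl -mulrA.
  rewrite -scaler_sumr -mulr_sumr -qE -scalerAl -scalerDr.
  by rewrite mulrC -scalerA bE scalerK.
case: (unliftP ord0 j) => [j'|] ->; last exact: dvdp_gcdl.
by apply: dvdp_trans (q_dvd j'); apply: dvdp_gcdr.
Qed.

Section SecantSpaces.
Variables (K : closedFieldType) (n : nat) (g : 'M[K]_n.+1).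
Hypothesis gU : g \in unitmx.

Lemma veronese_mul_col (c : 'cV[K]_n.+1) t :
  veronese n 1 t *m c = (col_poly c).[t]%:M.
Proof.
apply/rowP => i; rewrite ord1 !mxE eqxx col_polyE horner_sum.
apply: eq_bigr => k _.
by rewrite mxE expr1n mul1r hornerZ hornerXn mulrC.
Qed.

(** Forms vanishing on the span vanish at the points [t j], so they restrict to multiples of the
    product [q] of the ['X - t j]. Conversely, each multiple of [q] of degree at most [n] is the
    restriction of a linear form vanishing on the span. *)
Lemma intersection_degree_secant m (t : 'I_m -> K) :
  (m <= n)%N -> injective t ->
  intersection_degree (curve g)
    [set v | v \in <<[seq veronese n 1 (t j) *m g | j : 'I_m]>>%VS]%classic m.
Proof.
move=> le_mn t_inj; set V := <<_>>%VS.
pose rs := [seq t j | j : 'I_m]; pose q := \prod_(x <- rs) ('X - x%:P).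
have srs : size rs = m by rewrite size_map size_enum_ord.
have urs : uniq rs by rewrite map_inj_uniq ?enum_uniq.
have sq : size q = m.+1 by rewrite size_prod_XsubC srs.
have q0 : q != 0 by rewrite -size_poly_gt0 sq.
have Vv j : veronese n 1 (t j) *m g \in V.
  by apply: memv_span; apply/mapP; exists j; rewrite ?mem_enum.
have ann (f : {poly K}) : (size f <= n.+1)%N -> q %| f -> ann_poly g V f.
  move=> sf q_f; exists (invmx g *m \col_i f`_i); last first.
    by rewrite mulKVmx // col_polyK.
  pose F := linfun (mulmxr (invmx g *m \col_(i < n.+1) f`_i) : 'rV_n.+1 -> 'rV_1).
  suff sub : (V <= lker F)%VS.
    by move=> v /(subvP sub); rewrite memv_ker lfunE /= => /eqP.
  apply/span_subvP => _ /mapP[j _ ->]; rewrite memv_ker lfunE /=.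
  rewrite -mulmxA mulKVmx // veronese_mul_col col_polyK //.
  suff /rootP -> : root f (t j) by rewrite raddf0.
  rewrite -dvdp_XsubCl; apply: dvdp_trans q_f.
  rewrite dvdp_XsubCl root_prod_XsubC.
  by apply/mapP; exists j; rewrite ?mem_enum.
have -> : m = (size q).-1 by rewrite sq.
apply: intersection_degree_curve => //; first by rewrite sq.
  move=> d y hy; apply: uniq_roots_dvdp; last by rewrite uniq_rootsE.
  apply/allP => _ /mapP[j _ ->]; apply/rootP.
  by rewrite horner_curve_restr; apply: hy; apply: Vv.
(* The role of [u0] is played by [q * 'X^(n - m)], a multiple of [q] of exact degree [n]. *)
move=> d r d_gt1 sqr; have := @curve_restr_cone_ideal_mul _ _ g gU V d 1
  (fun=> q) (fun=> 1) (q * 'X^(n - m)) r d_gt1.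
have su : size (q * 'X^(n - m)) = n.+1.
  by rewrite size_mulXn // sq addnS subnK.
rewrite !big_ord1 mul1r; apply=> //.
  by apply: ann; rewrite ?su ?dvdp_mulr.
by move=> _; apply: ann; rewrite ?sq.
Qed.

(* The ideal of [V] restricts to the multiples of [q]; the intersection degree
   forces [deg q = m], and then, comparing dimensions, the linear forms
   vanishing on [V] restrict to all multiples of [q] of degree at most [n]. *)
Lemma intersection_degree_recurrence m (V : {vspace 'rV[K]_n.+1}) :
  \dim V = m -> (m <= n)%N -> row ord_max g \notin V ->
  intersection_degree (curve g) [set v | v \in V]%classic m ->
  exists q : {poly K}, [/\ q \is monic, size q = m.+1 &
    forall v b, v \in V -> (b + m <= n)%N ->
      \sum_i (v *m invmx g) ord0 i * ('X^b * q)`_i = 0].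
Proof.
move=> dimV le_mn gV deg.
have := span_rows_vbasis V; set B := \matrix_i _ => VE.
pose C := cokermx B.
have memV v : (v \in V) = (v *m C == 0).
  by rewrite [in LHS]VE mem_span_rows submxE.
pose u j := col_poly (g *m col j C).
have ann_u j : ann_poly g V (u j).
  exists (col j C) => // v; rewrite memV => /eqP vC.
  by rewrite -col_mulmx vC col0.
(* Since [V] misses the point at infinity, some linear form vanishing on [V] is non-zero there, and
   its restriction has exact degree [n]. *)
have [j0 j0P] : exists j0, (g *m C) ord_max j0 != 0.
  move: gV; rewrite memV => /rV0Pn[j0]; rewrite -row_mul mxE.
  by exists j0.
have su0 : size (u j0) = n.+1.
  apply/eqP; rewrite eqn_leq size_col_poly ltnNge; apply/negP => le_s.
  move: j0P.
  have := coef_col_poly (g *m col j0 C) ord_max.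
  rewrite -/(u j0) nth_default // -col_mulmx mxE => <-.
  by rewrite eqxx.
have [q1 [a [q1E q1_dvd]]] := bezout_family u.
have u00 : u j0 != 0 by rewrite -size_poly_gt0 su0.
have q10 : q1 != 0 by apply: dvdpN0 (q1_dvd j0) u00.
have sq1n : (size q1 <= n.+1)%N by rewrite -su0 dvdp_leq.
have le_m : (m <= (size q1).-1)%N.
  apply: intersection_degree_leq deg _ q10 sq1n => // d r d_gt1.
  rewrite q1E; exact: (curve_restr_cone_ideal_mul gU d_gt1 (ann_u j0)).
pose q := (lead_coef q1)^-1 *: q1.
have lc0 : (lead_coef q1)^-1 != 0 by rewrite invr_eq0 lead_coef_eq0.
have sq : size q = size q1 by rewrite size_scale.
have q_dvd j : q %| u j by rewrite dvdpZl.
have q0 : q != 0 by rewrite scaler_eq0 (negPf lc0).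
pose e := (size q).-1.
have szq : size q = e.+1 by rewrite prednK // size_poly_gt0.
(* The rows of [T] are the shifts of [q], those of [D] the restrictions of linear forms spanning the
   annihilator of [V]. *)
pose T : 'M[K]_(n.+1 - e, n.+1) := \matrix_(b, i) ('X^b * q)`_i.
pose D := (g *m C)^T.
have DT : (D <= T)%MS.
  apply/row_subP => j; apply/submxP; have /dvdpP[r rE] := q_dvd j.
  have r0 : (size r <= n.+1 - e)%N.
    have [->|r0] := eqVneq r 0; first by rewrite size_poly0.
    have : (size (r * q)%R <= n.+1)%N by rewrite -rE size_col_poly.
    rewrite size_mul // szq; move: (size r) => x; lia.
  exists (poly_rV r); apply/rowP => i; rewrite [LHS]mxE [LHS]mxE [RHS]mxE.
  have := coef_col_poly (g *m col j C) i; rewrite -/(u j) -col_mulmx mxE => <-.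
  rewrite -(poly_rV_K r0) in rE; rewrite rE.
  rewrite /rVpoly poly_def mulr_suml coef_sum; apply: eq_bigr => b _.
  rewrite insubT //= => lt_b; rewrite !mxE -scalerAl coefZ.
  by congr (_ * _); congr (r`_ _).
have rankD : \rank D = (n.+1 - m)%N.
  rewrite mxrank_tr eqmxMfull ?row_full_unit // mxrank_coker.
  by rewrite -dimV [in RHS]VE dim_span_rows.
(* The rank of [D] is at most the number of rows of [T], so [e <= m]; the intersection degree gave
   [m <= e]. *)
have em : e = m.
  have := leq_trans (mxrankS DT) (rank_leq_row T); rewrite rankD.
  have le_en : (e <= n)%N by rewrite -ltnS -szq sq.
  by rewrite -sq -/e in le_m; lia.
have TD : (T <= D)%MS.
  have := mxrank_leqif_sup DT; rewrite -(geq_leqif (mxrank_leqif_sup DT)).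
  by rewrite rankD -em rank_leq_row.
exists q; split; first by rewrite monicE lead_coefZ mulVf // lead_coef_eq0.
  by rewrite szq em.
move=> v b; rewrite memV => /eqP vC le_b.
have lt_b : (b < n.+1 - e)%N by rewrite em; lia.
have /submxP[w wE] : (row (Ordinal lt_b) T <= D)%MS.
  by apply: submx_trans TD; apply: row_sub.
have : v *m invmx g *m (row (Ordinal lt_b) T)^T = 0.
  rewrite wE trmx_mul trmxK -(mulmxA g C) (mulmxA (v *m invmx g)) mulmxKV //.
  by rewrite (mulmxA v C) vC mul0mx.
move/rowP/(_ ord0); rewrite !mxE => s0; rewrite -[RHS]s0.
by apply: eq_bigr => i _; rewrite !mxE.
Qed.

End SecantSpaces.

(** * Algebraic dependence *)


Lemma mdeg_geq m (u : 'X_{1..m}) i : (u i <= mdeg u)%N.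
Proof. by rewrite mdegE (bigD1 i) //= leq_addr. Qed.

(** Uniqueness of base [b] digits: distinct monomials keep distinct exponents under the Kronecker
    substitution below. *)
Lemma digits_inj m b (u v : 'I_m -> nat) :
  (forall i, u i < b)%N -> (forall i, v i < b)%N ->
  (\sum_i u i * b ^ i = \sum_i v i * b ^ i)%N -> u =1 v.
Proof.
elim: m u v => [|m IH] u v hu hv; first by move=> _ [].
rewrite !big_ord_recl !expn0 !muln1.
have shift w : (\sum_(i < m) w (lift ord0 i) * b ^ (lift ord0 i)
    = b * \sum_(i < m) w (lift ord0 i) * b ^ i)%N.
  by rewrite big_distrr; apply: eq_bigr => i _ /=; rewrite expnS mulnCA.
rewrite !shift => e.
have b_gt0 : (0 < b)%N := leq_ltn_trans (leq0n _) (hu ord0).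
have e0 : u ord0 = v ord0.
  have := congr1 (modn^~ b) e.
  by rewrite ![(b * _)%N]mulnC ![(_ + _ * b)%N]addnC !modnMDl !modn_small.
move=> i; case: (unliftP ord0 i) => [j|] -> //.
apply: (IH (fun j => u (lift ord0 j)) (fun j => v (lift ord0 j))) => //.
by move/eqP: e; rewrite e0 eqn_add2l eqn_pmul2l // => /eqP.
Qed.

(* Kronecker substitution. *)
Lemma mpoly_neq0_eval (K : closedFieldType) m (f : {mpoly K[m]}) :
  f != 0 -> exists v, f.@[v] != 0.
Proof.
move=> f0; pose b := (msize f).+1.
pose F := mmap polyC (fun j : 'I_m => 'X^(b ^ j)) f.
suff /closed_nonrootP[x] : F != 0.
  by rewrite /root horner_mmap; exists (fun j => ('X^(b ^ j)).[x]).
pose k u := (\sum_(i < m) (u : 'X_{1..m}) i * b ^ i)%N.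
have FE : F = \sum_(u <- msupp f) f@_u *: 'X^(k u).
  rewrite /F /mmap; apply: eq_bigr => u _; rewrite mul_polyC; congr (_ *: _).
  rewrite /mmap1 /k (big_morph _ (exprD _) (expr0 _)).
  by apply: eq_bigr => i _; rewrite -exprM mulnC.
have lt_b u : u \in msupp f -> forall i, (u i < b)%N.
  move=> fu i; apply: leq_ltn_trans (mdeg_geq u i) _.
  by rewrite ltnS ltnW // msize_mdeg_lt.
have fl : mlead f \in msupp f by apply: mlead_supp.
(* Only the leading monomial of [f] contributes to the coefficient of [F] at [k (mlead f)]. *)
apply: contraNneq f0 => F0; have := congr1 (fun p : {poly K} => p`_(k (mlead f))) F0.
rewrite FE coef_sum coef0 (bigD1_seq (mlead f)) ?msupp_uniq //=.
rewrite coefZ coefXn eqxx mulr1 big_seq_cond big1 ?addr0 => [fl0|u /andP[fu neq_u]].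
  by move: fl; rewrite mcoeff_msupp fl0 eqxx.
rewrite coefZ coefXn; case: eqP => [e|]; last by rewrite mulr0.
case/eqP: neq_u; apply/mnmP => i; apply/esym.
by apply: (digits_inj (lt_b _ fl) (lt_b _ fu) e).
Qed.

Lemma msize_prod_exp (K : fieldType) N M D (G : 'I_M -> {mpoly K[N]})
  (F : 'I_M -> nat) :
  (forall j, msize (G j) <= D.+1)%N ->
  (msize (\prod_j G j ^+ F j)%R <= (D * \sum_j F j).+1)%N.
Proof.
move=> hD; have msizeM (p q : {mpoly K[N]}) a b :
    (msize p <= a.+1)%N -> (msize q <= b.+1)%N ->
    (msize (p * q)%R <= (a + b).+1)%N.
  have [->|p0] := eqVneq p 0; first by rewrite mul0r msize0.
  have [->|q0] := eqVneq q 0; first by rewrite mulr0 msize0.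
  by rewrite msizeM //; move: (msize p) (msize q) => x y; lia.
elim/big_ind2: _ => [||j _]; first by rewrite msize1.
  by move=> p a q b hp hq; rewrite mulnDr; apply: msizeM.
elim: (F j) => [|k IH]; first by rewrite expr0 msize1.
by rewrite exprS mulnS; apply: msizeM.
Qed.

(* Counting: the [d ^ M] monomials with exponents below [d] are mapped into a
   space of dimension at most [(D * M * d).+1 ^ N]. *)
Lemma alg_dependent (K : fieldType) N M (G : 'I_M -> {mpoly K[N]}) :
  (N < M)%N ->
  exists2 f : {mpoly K[M]}, f != 0 &
    forall v, f.@[fun j => (G j).@[v]] = 0.
Proof.
move=> lt_NM; pose D := \max_j msize (G j).
have hD j : (msize (G j) <= D.+1)%N by apply: ltnW; rewrite ltnS leq_bigmax.
(* All [P F] below have size at most [e]. As [e <= (D * M).+1 * d] and [(D * M).+1 ^ N < d], one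
   gets [e ^ N < d ^ N.+1 <= d ^ M]. *)
pose d := ((D * M).+1 ^ N).+1; pose e := (D * (M * d)).+1.
pose I := {ffun 'I_M -> 'I_d}; pose J := {ffun 'I_N -> 'I_e}.
pose P (F : I) := \prod_j G j ^+ F j.
have sP F : (msize (P F) <= e)%N.
  apply: leq_trans (msize_prod_exp _ hD) _; rewrite ltnS leq_mul2l.
  apply/orP; right; rewrite -[M in (M * d)%N]card_ord -sum_nat_const.
  by apply: leq_sum => j _; apply: ltnW.
pose A : 'M[K]_(#|I|, #|J|) :=
  \matrix_(r, c) (P (enum_val r))@_[multinom (enum_val c : J) i : nat | i < N].
have card_lt : (#|J| < #|I|)%N.
  rewrite !card_ffun !card_ord; apply: (@leq_ltn_trans ((D * M).+1 ^ N * d ^ N)).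
    have leq_exp a b k : (a <= b)%N -> (a ^ k <= b ^ k)%N.
      by move=> le_ab; elim: k => // k IH; rewrite !expnS leq_mul.
    by rewrite -expnMn leq_exp // /e mulSn mulnA -[X in (X <= _)%N]add1n leq_add2r.
  apply: (@leq_trans (d ^ N.+1)); last by rewrite leq_pexp2l.
  by rewrite expnS ltn_mul2r expn_gt0 ltnS leqnn.
have : kermx A != 0.
  rewrite -mxrank_eq0 mxrank_ker subn_eq0 -ltnNge.
  by apply: leq_ltn_trans (rank_leq_col A) card_lt.
move/rowV0Pn => [w /sub_kermxP wA w0].
have [r0 wr0] := rV0Pn _ w0.
pose mon (F : I) := [multinom F j : nat | j < M].
have mon_inj : injective mon.
  move=> F F' /mnmP eF; apply/ffunP => j; apply: val_inj.
  by have := eF j; rewrite !mnmE.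
pose f := \sum_r w 0 r *: 'X_[mon (enum_val r)] : {mpoly K[M]}.
have fG : \sum_r w 0 r *: P (enum_val r) = 0.
  apply/mpolyP => u; rewrite mcoeff0 raddf_sum /=.
  case: (pickP (fun i => e <= u i)%N) => [i le_u|no_i]; last first.
    have lt_u i : (u i < e)%N by rewrite ltnNge no_i.
    pose c : J := [ffun i => Ordinal (lt_u i)].
    have /rowP/(_ (enum_rank c)) := wA; rewrite !mxE => s0; rewrite -[RHS]s0.
    apply: eq_bigr => r _; rewrite mcoeffZ mxE enum_rankK; congr (_ * _@_ _).
    by apply/mnmP => i; rewrite mnmE ffunE.
  rewrite big1 // => r _; rewrite mcoeffZ memN_msupp_eq0 ?mulr0 //.
  apply/negP => /msize_mdeg_lt; apply/negP; rewrite -leqNgt.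
  by apply: leq_trans (sP _) (leq_trans le_u (mdeg_geq _ _)).
exists f.
  apply: contraNneq wr0 => /(congr1 (fun p => p@_(mon (enum_val r0)))).
  rewrite mcoeff0 raddf_sum (bigD1 r0) //= mcoeffZ mcoeffX eqxx mulr1.
  rewrite big1 ?addr0 => [-> //|r neq_r].
  rewrite mcoeffZ mcoeffX; case: eqP => [/mon_inj/enum_val_inj er|].
    by rewrite er eqxx in neq_r.
  by rewrite mulr0.
move=> v; rewrite -[RHS](meval0 v) -fG !raddf_sum; apply: eq_bigr => r _ /=.
rewrite !mevalZ mevalX rmorph_prod; congr (_ * _).
by apply: eq_bigr => j _; rewrite rmorphXn mnmE.
Qed.

(** * Linear recurrences *)


Section MoveInfinity.
Variables (K : closedFieldType) (n : nat).

(* The action on binary forms of degree [n] of [(s, t) |-> (s + a t, t)]. *)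
Definition shift_mx (a : K) : 'M[K]_n.+1 :=
  \matrix_(j, i) (a ^+ (j - i) *+ 'C(n - i, j - i) *+ (i <= j)%N).

Lemma shift_mx_unit a : shift_mx a \in unitmx.
Proof.
rewrite unitmxE det_trig.
  by rewrite big1 ?unitr1 // => i _; rewrite mxE subnn bin0 leqnn.
by apply/is_trig_mxP => j i lt_ji; rewrite mxE leqNgt lt_ji.
Qed.

Lemma veronese_shift a s t :
  veronese n s t *m shift_mx a = veronese n (s + a * t) t.
Proof.
apply/rowP => i; rewrite !mxE exprDn big_distrl /=.
pose F j := s ^+ (n - j) * t ^+ j * (a ^+ (j - i) *+ 'C(n - i, j - i) *+ (i <= j)%N).
rewrite (eq_bigr (fun j : 'I_n.+1 => F j)) => [|j _]; last by rewrite !mxE.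
have le_in : (i <= n)%N by rewrite -ltnS.
rewrite -(big_mkord xpredT F) (@big_cat_nat _ _ _ i) //=; last exact: leqW.
rewrite big_nat big1 ?add0r => [|j /andP[_ lt_ji]]; last first.
  by rewrite /F leqNgt lt_ji mulr0.
rewrite -{1}(add0n (i : nat)) big_addn subSn // big_mkord.
apply: eq_bigr => k _; rewrite /F addnK leq_addl mulr1n exprMn exprD.
rewrite -subnDA [(k + i)%N]addnC !mulrnAr mulrnAl; congr (_ *+ _).
by rewrite -!mulrA; congr (_ * _); rewrite mulrCA mulrC -mulrA mulrCA mulrA.
Qed.

Lemma curve_shift a (g : 'M[K]_n.+1) : curve (shift_mx a *m g) = curve g.
Proof.
apply/seteqP; split=> _ [_ [c [s [t ->]]] <-].
  exists (c *: veronese n (s + a * t) t); first by exists c, (s + a * t), t.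
  by rewrite mulmxA -[c *: _ *m shift_mx a]scalemxAl veronese_shift.
exists (c *: veronese n (s - a * t) t); first by exists c, (s - a * t), t.
by rewrite mulmxA -[c *: _ *m shift_mx a]scalemxAl veronese_shift subrK.
Qed.

Lemma row_max_shift a (g : 'M[K]_n.+1) :
  row ord_max (shift_mx a *m g) = veronese n a 1 *m g.
Proof.
have -> : veronese n a 1 = veronese n 0 1 *m shift_mx a.
  by rewrite veronese_shift add0r mulr1.
rewrite -mulmxA rowE; congr (_ *m _); apply/rowP => i.
rewrite !mxE expr1n mulr1 expr0n subn_eq0 /= -val_eqE eqn_leq.
by rewrite -[(i <= n)%N]ltnS ltn_ord.
Qed.

(** Each [V c] lies in a hyperplane [l c], whose equation at the point [veronese n a 1 *m g] is a
    non-zero polynomial in [a]. Some [a] is a root of none of these, and the shift by [a] puts this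
    point at infinity without changing the curve. *)
Lemma curve_avoid_infinity (C : finType) (V : C -> {vspace 'rV[K]_n.+1})
  (g : 'M[K]_n.+1) :
  g \in unitmx -> (forall c, \dim (V c) <= n)%N ->
  exists g' : 'M[K]_n.+1, [/\ g' \in unitmx, curve g' = curve g &
    forall c, row ord_max g' \notin V c].
Proof.
move=> gU dimV.
have /fin_all_exists2[l annl l0] c :
    exists2 l : 'cV[K]_n.+1, annihilates (V c) l & l != 0.
  have VE := span_rows_vbasis (V c); set B := \matrix_i _ in VE.
  have /negP cok0 : cokermx B != 0.
    rewrite -mxrank_eq0 mxrank_coker subn_eq0 -ltnNge ltnS.
    by have := dimV c; rewrite {1}VE dim_span_rows.
  have [j cj0] : exists j, col j (cokermx B) != 0.
    apply/existsP; rewrite -negb_forall; apply/negP => /forallP all0.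
    apply: cok0; apply/eqP/matrixP => i j.
    by have /eqP/colP/(_ i) := all0 j; rewrite !mxE.
  exists (col j (cokermx B)) => // v.
  rewrite {1}VE mem_span_rows submxE => /eqP vB.
  by rewrite -col_mulmx vB col0.
(* The coefficients are reversed because the parameter is now [s = a], with [t = 1]. *)
pose r c := \col_i (g *m l c) (rev_ord i) ord0.
have rE a c : veronese n a 1 *m g *m l c = (col_poly (r c)).[a]%:M.
  apply/rowP => i; rewrite ord1 [RHS]mxE eqxx mulr1n col_polyE horner_sum.
  rewrite -mulmxA mxE (reindex_inj rev_ord_inj); apply: eq_bigr => k _.
  rewrite hornerZ hornerXn !mxE expr1n mulr1 mulrC; congr (_ * _ ^+ _).
  by rewrite /= subSS subKn // -ltnS.
have : \prod_c col_poly (r c) != 0.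
  apply/prodf_neq0 => c _; apply: contra (l0 c) => /eqP r0.
  rewrite -(mulKmx gU (l c)); suff -> : g *m l c = 0 by rewrite mulmx0.
  have /col_poly_inj/colP r00 : col_poly (r c) = col_poly (0 : 'cV[K]_n.+1).
    by rewrite r0 col_polyE big1 // => i _; rewrite mxE scale0r.
  by apply/colP => i; have := r00 (rev_ord i); rewrite !mxE rev_ordK.
case/closed_nonrootP => a; rewrite /root horner_prod => /prodf_neq0 ra.
exists (shift_mx a *m g); split; first by rewrite unitmx_mul shift_mx_unit.
  exact: curve_shift.
move=> c; rewrite row_max_shift; apply/negP => /annl; rewrite rE.
move/matrixP/(_ ord0 ord0); rewrite !mxE eqxx mulr1n => /eqP.
by apply/negP; apply: ra.
Qed.

End MoveInfinity.

(** * Recurrent sequences through companion matrices *)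

Section LinearRecurrences.
Variables (R : comNzRingType) (m n : nat).

(** A companion matrix: multiplying a window of [m.+1] consecutive terms, as a row vector, by it on
    the right advances the window by one term. *)
Definition recurrence_step (a : 'cV[R]_m.+1) : 'M[R]_m.+1 :=
  \matrix_(j, k) if k == ord_max then a j ord0 else (j == k.+1 :> nat)%:R.

(** Column [k] expresses the term of index [k] through the [m.+1] initial terms, with coefficients
    polynomial in [a]. *)
Definition recurrence_mx (a : 'cV[R]_m.+1) : 'M[R]_(m.+1, n.+1) :=
  \matrix_(j, k) (recurrence_step a ^+ k) j ord0.

Lemma recurrence_mxP (a : 'cV[R]_m.+1) (y : 'rV[R]_n.+1) : (m <= n)%N ->
  (forall b, (b + m < n)%N ->
    y ord0 (inord (b + m.+1)) = \sum_(k < m.+1) y ord0 (inord (b + k)) * a k ord0) ->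
  y = (\row_(j < m.+1) y ord0 (inord j)) *m recurrence_mx a.
Proof.
move=> le_mn rec_y; set y0 := \row_j _.
have step k (j : 'I_m.+1) : (k + j <= n)%N ->
    (y0 *m recurrence_step a ^+ k) ord0 j = y ord0 (inord (k + j)).
  elim: k j => [|k IH] j le_n; first by rewrite expr0 mulmx1 mxE.
  rewrite exprSr -mulmxE mulmxA mxE.
  have [j_max|j_max] := eqVneq j ord_max.
    rewrite j_max /= addSnnS rec_y; last by rewrite j_max in le_n.
    apply: eq_bigr => i _; rewrite [X in _ * X]mxE eqxx IH //.
    have := ltn_ord i; move: le_n; rewrite j_max /=; lia.
  have lt_j : (j.+1 < m.+1)%N.
    by rewrite ltn_neqAle ltn_ord andbT eqSS; apply: contra j_max => /eqP jm;
       apply/eqP/val_inj.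
  rewrite (bigD1 (Ordinal lt_j)) //= big1 => [|i ne_i]; last first.
    rewrite [X in _ * X]mxE (negPf j_max); case: eqP => [e|]; last by rewrite mulr0.
    by case/eqP: ne_i; apply: val_inj.
  by rewrite [X in _ * X]mxE (negPf j_max) eqxx mulr1 addr0 addSnnS IH /= -?addSnnS.
apply/rowP => k; transitivity ((y0 *m recurrence_step a ^+ k) ord0 ord0).
  rewrite step addn0 ?inord_val //; exact: leq_ord.
rewrite [LHS]mxE [RHS]mxE; apply: eq_bigr => j _; congr (_ * _).
by rewrite mxE.
Qed.

End LinearRecurrences.

Lemma map_recurrence_mx (R S : comNzRingType) (f : {rmorphism R -> S}) m n
  (a : 'cV[R]_m.+1) :
  map_mx f (recurrence_mx n a) = recurrence_mx n (map_mx f a).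
Proof.
have step : map_mx f (recurrence_step a) = recurrence_step (map_mx f a).
  by apply/matrixP => j k; rewrite !mxE; case: ifP; rewrite ?rmorph_nat.
apply/matrixP => j k; rewrite !mxE -step -rmorphXn /=.
by rewrite mxE.
Qed.

Lemma sum_coef_mulXn (K : idomainType) n m b (q : {poly K}) (y : 'rV[K]_n.+1) :
  size q = m.+2 -> (b + m < n)%N ->
  \sum_i y ord0 i * ('X^b * q)`_i =
  \sum_(k < m.+2) y ord0 (inord (b + k)) * q`_k.
Proof.
move=> sq lt_n; pose F i := y ord0 (inord i) * ('X^b * q)`_i.
rewrite (eq_bigr (fun i : 'I_n.+1 => F i)) => [|i _]; last by rewrite /F inord_val.
rewrite -(big_mkord xpredT F) (@big_cat_nat _ _ _ b) //=; last lia.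
rewrite big_nat big1 ?add0r => [|i /andP[_ lt_i]]; last first.
  by rewrite /F coefXnM lt_i mulr0.
rewrite (@big_cat_nat _ _ _ (m.+2 + b)) //=; [|lia|lia].
rewrite [X in _ + X]big_nat [X in _ + X]big1 ?addr0 => [|i /andP[le_i _]]; last first.
  rewrite /F nth_default ?mulr0 // (leq_trans (size_polyMleq _ _)) //.
  by rewrite size_polyXn sq; lia.
rewrite -{1}(add0n b) big_addn addnK big_mkord; apply: eq_bigr => k _.
by rewrite /F coefXnM ltnNge leq_addl addnK addnC.
Qed.

(** In the coordinates of the curve, each row of [A] is a recurrent sequence with monic
    characteristic polynomial [q]. So [P] holds the initial terms of the rows, and [a] the
    coefficients [- q_k]. *)
Lemma intersection_degree_frame (K : closedFieldType) n (g : 'M[K]_n.+1) m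
  (A : 'M[K]_(m.+1, n.+1)) (V : {vspace 'rV[K]_n.+1}) :
  g \in unitmx -> V = <<[seq row i A | i : 'I_m.+1]>>%VS ->
  \dim V = m.+1 -> (m < n)%N -> row ord_max g \notin V ->
  intersection_degree (curve g) [set v | v \in V]%classic m.+1 ->
  exists (P : 'M[K]_m.+1) a, A = P *m recurrence_mx n a *m g.
Proof.
move=> gU VE dimV lt_mn gV /(intersection_degree_recurrence gU dimV lt_mn gV).
move=> [q [/monicP q_monic sq rec_q]].
exists (\matrix_(i, j) (A *m invmx g) i (inord j)), (\col_k - q`_k).
rewrite -[LHS](mulmxKV gU); congr (_ *m _); apply/row_matrixP => i.
rewrite row_mul; set y := row i _.
have -> : row i (\matrix_(i, j) (A *m invmx g) i (inord j)) =
    \row_(j < m.+1) y ord0 (inord j).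
  by apply/rowP => j; rewrite !mxE; apply: eq_bigr => k _; rewrite ?mxE.
apply: recurrence_mxP; first exact: ltnW.
move=> b lt_b; have : row i A \in V.
  by rewrite VE; apply: memv_span; apply/mapP; exists i; rewrite ?mem_enum.
move/rec_q => /(_ b); rewrite addnS => /(_ lt_b).
rewrite -row_mul -/y (sum_coef_mulXn _ sq lt_b) big_ord_recr /=.
have -> : q`_m.+1 = 1 by move: q_monic; rewrite /lead_coef sq.
rewrite mulr1 addrC => /eqP; rewrite addr_eq0 => /eqP e; rewrite -addnS e.
by rewrite -sumrN; apply: eq_bigr => k _; rewrite mxE mulrN.
Qed.

(** * Non-feasibility by a parameter count *)


Lemma span_rows_vbasis_dim (K : fieldType) n m (V : {vspace 'rV[K]_n}) :
  \dim V = m ->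
  V = <<[seq row i (\matrix_(i < m) (vbasis V)`_i) | i : 'I_m]>>%VS.
Proof. by move=> <-; apply: span_rows_vbasis. Qed.

Lemma card_sig_sum (I : finType) (T : I -> finType) :
  #|{: {i : I & T i}}| = (\sum_i #|T i|)%N.
Proof. by rewrite card_tagged sumnE big_map big_enum. Qed.

(** * Frames as points of an affine space *)

Section FrameVariety.
Variables (K : closedFieldType) (n : nat) (L : weight_vector n).

Local Notation M := #|{: frame_index L}|.

Definition generic_frame (c : component L) :
    'M[{mpoly K[M]}]_((component_dim c).+1, n.+1) :=
  \matrix_(i, j) 'X_(enum_rank (Tagged
    (fun c => 'I_(component_dim c).+1 * 'I_n.+1)%type (i, j) : frame_index L)).

Lemma meval_generic_frame (A : frame K L) c :
  map_mx (meval (frame_entries A)) (generic_frame c) = A c.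
Proof.
by apply/matrixP => i j; rewrite !mxE mevalXU /frame_entries enum_rankK.
Qed.

Definition frame_of_entries (v : 'I_M -> K) : frame K L :=
  fun c => map_mx (meval v) (generic_frame c).

Lemma frame_of_entriesK v : frame_entries (frame_of_entries v) =1 v.
Proof.
move=> k; rewrite /frame_entries !mxE mevalXU; congr v.
by apply: enum_val_inj; rewrite enum_rankK; case: (enum_val k) => c [].
Qed.

Lemma frame_of_exists (La : configuration K L) : exists A, frame_of A La.
Proof.
exists (fun c => \matrix_(i < (component_dim c).+1) (vbasis (val (La c)))`_i).
by move=> c; apply: span_rows_vbasis_dim; apply/eqP/(valP (La c)).
Qed.

Lemma frame_row_free (A : frame K L) La c : frame_of A La -> row_free (A c).
Proof.
by move=> ALa; rewrite /row_free -dim_span_rows -ALa (valP (La c)).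
Qed.

Lemma configuration_of_frame (A : frame K L) :
  (forall c, row_free (A c)) -> exists La, frame_of A La.
Proof.
move=> freeA.
have dimA c : \dim <<[seq row i (A c) | i : 'I_(component_dim c).+1]>> ==
    (component_dim c).+1 by rewrite dim_span_row_free.
by exists (fun c => exist (fun V : {vspace 'rV[K]_n.+1} =>
  \dim V == (component_dim c).+1) _ (dimA c)).
Qed.

(** Irreducibility of the affine space of matrices: a polynomial witnessing that [U] is non-empty,
    [h], and determinants forcing full rank have a non-zero product, hence a common point of
    non-vanishing. *)
Lemma zariski_open_dense (U : set (configuration K L)) (h : {mpoly K[M]}) :
  zariski_open U -> (U !=set0)%classic -> h != 0 ->
  exists A La, [/\ frame_of A La, U La & h.@[frame_entries A] != 0].
Proof.
move=> [F openU] [La0 U0] h0; have [A0 frA0] := frame_of_exists La0.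
have [f Ff f0] := (openU _ _ frA0).1 U0.
(* The determinant [d c] of [A c *m B c] is 1 at [A0], so [d c] is a non-zero polynomial; where it
   does not vanish, [A c] has full rank. *)
have /fin_all_exists[B A0B] c : exists B, A0 c *m B = 1%:M.
  by apply/row_freeP; apply: frame_row_free frA0.
pose d c := \det (generic_frame c *m map_mx (@mpolyC M K) (B c)).
have dE A c : (d c).@[frame_entries A] = \det (A c *m B c).
  rewrite /d -det_map_mx map_mxM meval_generic_frame; congr (\det (_ *m _)).
  by apply/matrixP => i j; rewrite !mxE /= mevalC.
have : f * h * \prod_c d c != 0.
  rewrite !mulf_neq0 //.
    by apply: contraNneq f0 => ->; rewrite meval0.
  apply/prodf_neq0 => c _; apply: contraTneq (oner_neq0 K) => d0.
  by rewrite -(det1 _ (component_dim c).+1) -A0B -dE d0 meval0 eqxx.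
case/mpoly_neq0_eval => v; pose A := frame_of_entries v.
rewrite -(meval_eq _ (frame_of_entriesK v)) -/A !mevalM rmorph_prod.
rewrite !mulf_eq0 !negb_or => /andP[/andP[fA hA] /prodf_neq0 dA].
have [c|La frA] := @configuration_of_frame A.
  have := dA c isT; rewrite /= dE -unitfE -unitmxE => /mulmxV AB.
  apply/row_freeP; exists (B c *m invmx (A c *m B c)).
  by rewrite mulmxA.
by exists A, La; split=> //; apply/(openU _ _ frA); exists f.
Qed.

End FrameVariety.

Section NonFeasible.
Variables (K : closedFieldType) (n : nat) (L : weight_vector n).

Definition param : finType :=
  ('I_n.+1 * 'I_n.+1 + {c : component L &
    ('I_(component_dim c).+1 * 'I_(component_dim c).+1 +
     'I_(component_dim c).+1)})%type.

Local Notation N := #|param|.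

Definition generic_param (x : param) : {mpoly K[N]} := 'X_(enum_rank x).

Definition secant_frame (c : component L) :
    'M[{mpoly K[N]}]_((component_dim c).+1, n.+1) :=
  let T c := ('I_(component_dim c).+1 * 'I_(component_dim c).+1 +
     'I_(component_dim c).+1)%type in
  \matrix_(i, j) generic_param (inr (Tagged T (inl (i, j)))) *m
  recurrence_mx n (\col_k generic_param (inr (Tagged T (inr k)))) *m
  \matrix_(i, j) generic_param (inl (i, j)).

Lemma meval_secant_frame (g : 'M[K]_n.+1)
    (P : forall c : component L, 'M[K]_((component_dim c).+1))
    (a : forall c : component L, 'cV[K]_((component_dim c).+1)) :
  exists v, forall c, map_mx (meval v) (secant_frame c) =
    P c *m recurrence_mx n (a c) *m g.
Proof.
pose v x := match x : param with
  | inl ij => g ij.1 ij.2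
  | inr (existT c (inl ij)) => P c ij.1 ij.2
  | inr (existT c (inr k)) => a c k ord0
  end.
exists (v \o enum_val) => c.
rewrite !map_mxM map_recurrence_mx; congr (_ *m recurrence_mx n _ *m _).
- by apply/matrixP => i j; rewrite !mxE /generic_param /= mevalXU /= enum_rankK.
- by apply/matrixP => i j; rewrite !mxE /generic_param /= mevalXU /= enum_rankK ord1.
- by apply/matrixP => i j; rewrite !mxE /generic_param /= mevalXU /= enum_rankK.
Qed.

(** The entries of [secant_frame] satisfy a non-trivial algebraic relation [f]. Were [L] feasible,
    density would give a frame of a feasible configuration with [f] non-zero, although this frame is
    a value of [secant_frame]. *)
Lemma non_feasible_card :
  (#|param| < #|{: frame_index L}|)%N -> non_feasible K L.
Proof.
move=> lt_NM [U [openU U0 feasU]].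
pose G (k : 'I_#|{: frame_index L}|) :=
  let x := enum_val k in secant_frame (tag x) (tagged x).1 (tagged x).2.
have [f f0 fG] := alg_dependent G lt_NM.
have [A [La [frA ULa /eqP]]] := zariski_open_dense openU U0 f0; apply.
have [_ [g0 g0U ->] deg] := feasU _ ULa.
have dimLa c : \dim (val (La c)) = (component_dim c).+1.
  by apply/eqP/(valP (La c)).
have lt_n (c : component L) : (component_dim c < n)%N.
  by case: c => -[i lt_i] j /=; rewrite /component_dim /=; lia.
have [c|g [gU gg0 g_inf]] := curve_avoid_infinity (V := fun c => val (La c)) g0U.
  by rewrite dimLa.
have /fin_all_exists2[P _ /fin_all_exists[a AE]] c :
    exists2 P : 'M[K]_((component_dim c).+1), True &
      exists a, A c = P *m recurrence_mx n a *m g.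
  have [|P [a AE]] := intersection_degree_frame gU (frA c) (dimLa c) (lt_n c) (g_inf c).
    by rewrite gg0; apply: deg.
  by exists P => //; exists a.
have [v vE] := meval_secant_frame g P a.
rewrite -[RHS](fG v); apply: meval_eq => k; rewrite /G /frame_entries AE -vE.
by rewrite mxE.
Qed.

End NonFeasible.

Lemma non_feasible_ones (K : closedFieldType) n :
  (8 <= n)%N -> non_feasible K (fun _ : 'I_n.-1 => 1%N).
Proof.
move=> le_8n; apply: non_feasible_card.
rewrite card_sum card_prod !card_ord !card_sig_sum.
under eq_bigr do rewrite card_sum card_prod !card_ord.
under [X in (_ < X)%N]eq_bigr do rewrite card_prod !card_ord.
have sumE (F : nat -> nat) :
    (\sum_(c : component (fun _ : 'I_n.-1 => 1)) F (component_dim c) =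
     \sum_(i < n.-1) F i)%N.
  rewrite -(sig_big_dep (J := fun _ : 'I_n.-1 => 'I_1) xpredT (fun _ => xpredT)
    (fun i _ => F i)).
  by apply: eq_bigr => i _; rewrite big_ord1.
rewrite (sumE (fun i => i.+1 * i.+1 + i.+1)%N) (sumE (fun i => i.+1 * n.+1)%N).
rewrite -big_distrl /=.
(* With these sums the claim reads [(n+1)^2 + (n-1)n(n+1)/3 < (n+1)(n-1)n/2], that is,
   [n^2 - 7n - 6 > 0], and 8 is the first [n] for which this holds. *)
have s1 m : (\sum_(i < m) i.+1 * 2 = m * m.+1)%N.
  by elim: m => [|m IH]; rewrite ?big_ord0 // big_ord_recr /= IH; lia.
have s2 m : ((\sum_(i < m) (i.+1 * i.+1 + i.+1)) * 3 = m * m.+1 * m.+2)%N.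
  elim: m => [|m IH]; first by rewrite big_ord0.
  by rewrite big_ord_recr /= mulnDl IH; nia.
move: (s1 n.-1) (s2 n.-1); rewrite -big_distrl /=.
move: (\sum_(i < _) _)%N (\sum_(i < _) _)%N => x y.
by clear sumE; case: n le_8n => // n le_8n /=; nia.
Qed.

(** * General position *)


Lemma closed_field_uniq_seq (K : closedFieldType) k :
  exists2 s : seq K, uniq s & size s = k.
Proof.
elim: k => [|k [s us ss]]; first by exists [::].
have /closed_nonrootP[x] : \prod_(a <- s) ('X - a%:P) != 0.
  by rewrite monic_neq0 // monic_prod_XsubC.
rewrite root_prod_XsubC => x_s; exists (x :: s); last by rewrite /= ss.
by rewrite /= x_s.
Qed.

Section VeronesePoints.
Variables (K : closedFieldType) (n : nat).

(** The first [m] coordinates of the points form a transposed Vandermonde matrix. *)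
Lemma row_free_veronese m (x : 'I_m -> K) : injective x -> (m <= n.+1)%N ->
  row_free (\matrix_i veronese n 1 (x i)).
Proof.
move=> x_inj le_mn; apply: inj_row_free => w wY.
pose T := (Vandermonde m (\row_i x i))^T.
have TU : T \in unitmx.
  rewrite unitmx_tr unitmxE det_Vandermonde unitfE.
  apply/prodf_neq0 => i _; apply/prodf_neq0 => j lt_ij.
  by rewrite !mxE subr_eq0 (inj_eq x_inj) -val_eqE gtn_eqF.
rewrite -(mulmxK TU w); suff -> : w *m T = 0 by rewrite mul0mx.
apply/rowP => k; have /rowP/(_ (widen_ord le_mn k)) := wY; rewrite !mxE => s0.
rewrite -[RHS]s0; apply: eq_bigr => i _.
by rewrite !mxE expr1n mul1r.
Qed.

Lemma dim_veronese_points (s : seq K) (W : {vspace 'rV[K]_n.+1}) :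
  uniq s -> (size s <= n.+1)%N -> {in s, forall x, veronese n 1 x \in W} ->
  (size s <= \dim W)%N.
Proof.
move=> us ss sW; pose x (i : 'I_(size s)) := s`_i.
have x_inj : injective x.
  by move=> i j /eqP; rewrite nth_uniq // => /eqP/val_inj.
have := dim_span_row_free (row_free_veronese x_inj ss) => {1}<-.
apply: dimvS; apply/span_subvP => _ /mapP[i _ ->].
by rewrite rowK; apply/sW/mem_nth.
Qed.

End VeronesePoints.

Section GeneralPosition.
Variables (K : closedFieldType) (n : nat) (L : weight_vector n).

Definition expected_dim (s : {set component L}) : nat :=
  minn n.+1 (\sum_(c in s) (component_dim c).+1).

Definition general_position (La : configuration K L) : Prop :=
  forall s, (expected_dim s <= \dim (\sum_(c in s) val (La c)))%N.

(** This turns a lower bound on the dimension of a span into the non-vanishing of a polynomial in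
    the frame entries: [B] selects [r] vectors of the span, [C] projects them to [r] coordinates. *)
Lemma dim_sum_frameP (A : frame K L) La (s : {set component L}) r :
  frame_of A La ->
  (r <= \dim (\sum_(c in s) val (La c))%VS)%N <->
  exists (B : forall c, 'M[K]_(r, (component_dim c).+1)) (C : 'M_(n.+1, r)),
    \det ((\sum_(c in s) B c *m A c) *m C) != 0.
Proof.
move=> frA; set W := (\sum_(c in s) _)%VS; split=> [le_r|[B [C]]].
  have WE := span_rows_vbasis W; set D := \matrix_i _ in WE.
  have freeD : row_free D by rewrite /row_free -dim_span_rows -WE.
  pose Y : 'M_(r, n.+1) := pid_mx r *m D.
  have freeY : row_free Y.
    by rewrite /row_free mxrankMfree // rank_pid_mx.
  have /row_freeP[C YC] := freeY.
  have /fin_all_exists[w wY] (i : 'I_r) : exists w : forall c : component L,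
      'rV[K]_(component_dim c).+1, row i Y = \sum_(c in s) w c *m A c.
    have : row i Y \in W by rewrite WE mem_span_rows row_mul submxMl.
    case/memv_sumP => v vLa ->.
    have /fin_all_exists[w wE] c :
        exists w : 'rV[K]_(component_dim c).+1, c \in s -> v c = w *m A c.
      case: (boolP (c \in s)) => [cs|]; last by exists 0.
      have := vLa c cs; rewrite frA mem_span_rows => /submxP[u ->].
      by exists u.
    by exists w; apply: eq_bigr => c cs; apply: wE.
  exists (fun c => \matrix_i w i c), C.
  rewrite (_ : \sum_(c in s) _ = Y) ?YC ?det1 ?oner_neq0 //.
  apply/row_matrixP => i; rewrite wY linear_sum; apply: eq_bigr => c _ /=.
  by rewrite row_mul rowK.
rewrite -unitfE -unitmxE => /mulmxV; set Y := \sum_(c in s) _ => YC.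
have freeY : row_free Y.
  by apply/row_freeP; exists (C *m invmx (Y *m C)); rewrite mulmxA.
rewrite -[X in (X <= _)%N](dim_span_row_free freeY).
apply: dimvS; apply/span_subvP => _ /mapP[i _ ->].
rewrite linear_sum; apply: memv_sumr => c cs /=.
by rewrite frA mem_span_rows row_mul submxMl.
Qed.

Lemma zariski_open_general_position :
  zariski_open (general_position : set (configuration K L)).
Proof.
pose M := #|{: frame_index L}|.
pose f (s : {set component L})
    (B : forall c : component L, 'M[K]_(expected_dim s, (component_dim c).+1))
    (C : 'M[K]_(n.+1, expected_dim s)) : {mpoly K[M]} :=
  \det ((\sum_(c in s) map_mx (@mpolyC M K) (B c) *m generic_frame K c) *m
    map_mx (@mpolyC M K) C).
have fE s B C (A : frame K L) :
    (f s B C).@[frame_entries A] = \det ((\sum_(c in s) B c *m A c) *m C).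
  have mapC m1 m2 (X : 'M[K]_(m1, m2)) :
      map_mx (meval (frame_entries A)) (map_mx (@mpolyC M K) X) = X.
    by apply/matrixP => i j; rewrite !mxE /= mevalC.
  rewrite /f -det_map_mx map_mxM map_mx_sum mapC; congr (\det (_ *m _)).
  by apply: eq_bigr => c _; rewrite map_mxM mapC meval_generic_frame.
(* A family of polynomials describes a union of non-vanishing loci, while general position is a
   conjunction over all [s]; hence the products over [s]. *)
exists [set h | exists B C, h = \prod_s f s (B s) (C s)]%classic => A La frA.
split=> [gp|[_ [B [C ->]]]]; last first.
  rewrite rmorph_prod => /prodf_neq0 neq0 s; apply/(dim_sum_frameP _ _ frA).
  by exists (B s), (C s); rewrite -fE; apply: neq0.
have /fin_all_exists[B /fin_all_exists[C BC]] s :=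
  (dim_sum_frameP s _ frA).1 (gp s).
exists (\prod_s f s (B s) (C s)); first by exists B, C.
by rewrite rmorph_prod; apply/prodf_neq0 => s _; rewrite /= fE.
Qed.

(** The spanning points of all components together get distinct parameters on the standard curve. At
    most [n.+1] such points are always independent, so every subfamily spans the expected
    dimension. *)
Lemma general_position_secant : exists (La : configuration K L)
  (t : forall c : component L, 'I_(component_dim c).+1 -> K),
  [/\ general_position La, forall c, injective (t c) &
      forall c, val (La c) =
        <<[seq row j (\matrix_i veronese n 1 (t c i))
             | j : 'I_(component_dim c).+1]>>%VS].
Proof.
pose I := {c : component L & 'I_(component_dim c).+1}.
have [ts uts sts] := closed_field_uniq_seq K #|{: I}|.
pose tI (x : I) := ts`_(enum_rank x).
have tI_inj : injective tI.
  move=> x y /eqP; rewrite nth_uniq ?sts ?ltn_ord // => /eqP/val_inj.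
  exact: enum_rank_inj.
pose t (c : component L) (i : 'I_(component_dim c).+1) := tI (Tagged _ i).
have t_inj c : injective (t c).
  by move=> i j /tI_inj /eqP; rewrite eq_Tagged => /eqP.
have le_n (c : component L) : ((component_dim c).+1 <= n.+1)%N.
  by case: c => -[i lt_i] j /=; rewrite /component_dim /=; lia.
have [c|La frLa] := @configuration_of_frame K n L
    (fun c => \matrix_i veronese n 1 (t c i)).
  exact: row_free_veronese.
exists La, t; split=> // s.
pose xs := [seq tI x | x <- enum [pred x : I | tag x \in s]].
have sxs : size xs = (\sum_(c in s) (component_dim c).+1)%N.
  rewrite size_map -cardE -sum1_card.
  under [RHS]eq_bigr do rewrite -[_.+1]card_ord -sum1_card.
  rewrite sig_big_dep; apply: eq_bigl => x /=.
  by rewrite !inE andbT.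
have szt : size (take (expected_dim s) xs) = expected_dim s.
  by rewrite size_take_min sxs /expected_dim -minnA minnn.
rewrite -szt; apply: dim_veronese_points.
- by rewrite take_uniq // map_inj_uniq ?enum_uniq.
- by rewrite szt geq_minl.
move=> _ /mem_take/mapP[[c i] cs ->]; rewrite mem_enum inE /= in cs.
apply: (subvP (sumv_sup c cs (subvv _))); rewrite frLa; apply: memv_span.
by apply/mapP; exists i; rewrite ?mem_enum // rowK.
Qed.

End GeneralPosition.

(** * Normal forms and feasibility *)


Section NormalForm.
Variables (K : closedFieldType) (n : nat) (L : weight_vector n).
Variables (piv sub : seq (seq nat)).

(** The tables [piv] and [sub] encode a normal form: the component of dimension [d] is spanned by
    the differences of the basis vectors numbered [pivot d i] and [subtr d i], for [i <= d]. *)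
Definition pivot d i := nth 0 (nth [::] piv d) i.

(* Out of range, [subtr] points past the end of a basis [es] of length [n.+1],
   so that the default [0] of [es`_(subtr d i)] is subtracted. *)
Definition subtr d i := nth n.+1 (nth [::] sub d) i.

(** A boolean test, settled by computation for concrete tables, under which the pivot columns of
    each [normal_form c] form an identity matrix. *)
Definition valid_normal_form :=
  all (fun d => all (fun i => (pivot d i <= n)%N &&
    all (fun j => ((pivot d i == pivot d j) ==> (i == j)) &&
      (subtr d i != pivot d j)) (iota 0 d.+1)) (iota 0 d.+1)) (iota 0 n.-1).

Definition adapted (La : configuration K L) (es : seq 'rV[K]_n.+1) :=
  [/\ size es = n.+1, free es & forall c i, (i <= component_dim c)%N ->
    es`_(pivot (component_dim c) i) - es`_(subtr (component_dim c) i)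
      \in val (La c)].

Definition normal_form (c : component L) :
    'M[K]_((component_dim c).+1, n.+1) :=
  \matrix_(i, k) ((k == pivot (component_dim c) i :> nat)%:R -
                  (k == subtr (component_dim c) i :> nat)%:R).

Hypothesis valid : valid_normal_form.

Lemma component_dim_lt (c : component L) : (component_dim c < n.-1)%N.
Proof. exact: ltn_ord. Qed.

Lemma validP c (i : 'I_(@component_dim n L c).+1) :
  (pivot (component_dim c) i <= n)%N /\
  forall j : 'I_(component_dim c).+1,
    (pivot (component_dim c) i == pivot (component_dim c) j) = (i == j) /\
    subtr (component_dim c) i != pivot (component_dim c) j.
Proof.
have mem_d : component_dim c \in iota 0 n.-1.
  by rewrite mem_iota add0n component_dim_lt.
have mem_i (k : 'I_(component_dim c).+1) :
  (k : nat) \in iota 0 (component_dim c).+1 by rewrite mem_iota add0n ltn_ord.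
have := allP (allP valid _ mem_d) _ (mem_i i).
case/andP => le_n /allP hj.
split=> // j; have /andP[/implyP h ->] := hj _ (mem_i j); split=> //.
by apply/eqP/eqP => [/eqP/h/eqP/val_inj|->].
Qed.

Lemma normal_form_free c : row_free (normal_form c).
Proof.
apply/row_freeP; exists (\matrix_(k, j) (k == pivot (component_dim c) j :> nat)%:R).
apply/matrixP => i j; rewrite !mxE.
have [le_j _] := validP j; rewrite -ltnS in le_j.
rewrite (bigD1 (Ordinal le_j)) //= big1 => [|k neq_k]; last first.
  by rewrite -val_eqE /= in neq_k; rewrite !mxE (negPf neq_k) mulr0.
rewrite !mxE /= eqxx mulr1 addr0.
have [_ /(_ j)[ej sj]] := validP i.
by rewrite eq_sym ej eq_sym (eq_sym _ (subtr _ _)) (negPf sj) subr0 eq_sym.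
Qed.

Lemma sum_delta_nth (es : seq 'rV[K]_n.+1) k : size es = n.+1 ->
  \sum_(i < n.+1) (i == k :> nat)%:R *: es`_i = es`_k.
Proof.
move=> ses; have [lt_k|le_k] := ltnP k n.+1.
  rewrite (bigD1 (Ordinal lt_k)) //= eqxx scale1r big1 ?addr0 // => i neq_i.
  by rewrite -val_eqE /= in neq_i; rewrite (negPf neq_i) scale0r.
rewrite nth_default ?ses // big1 // => i _.
by rewrite ltn_eqF ?scale0r // (leq_trans (ltn_ord i)).
Qed.

Lemma adaptedE (La : configuration K L) es : adapted La es ->
  exists2 E : 'M[K]_n.+1, E \in unitmx & forall c,
    val (La c) =
      <<[seq row i (normal_form c *m E) | i : 'I_(component_dim c).+1]>>%VS.
Proof.
move=> [ses fes mem_es]; pose E : 'M[K]_n.+1 := \matrix_(i < n.+1) es`_i.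
have EU : E \in unitmx.
  rewrite -row_free_unit /row_free -dim_span_rows.
  have -> : [seq row i E | i : 'I_n.+1] = es.
    apply: (@eq_from_nth _ 0) => [|i]; rewrite size_map size_enum_ord // => lt_i.
    by rewrite (nth_map (Ordinal lt_i)) ?size_enum_ord // rowK nth_enum_ord.
  by move: fes; rewrite /free ses.
exists E => // c; apply/eqP; rewrite eq_sym eqEdim; apply/andP; split.
  apply/span_subvP => _ /mapP[i _ ->].
  suff -> : row i (normal_form c *m E) = es`_(pivot (component_dim c) i) -
      es`_(subtr (component_dim c) i) by apply: mem_es; rewrite -ltnS.
  rewrite row_mul mulmx_sum_row -!(sum_delta_nth _ ses) -sumrB.
  by apply: eq_bigr => k _; rewrite !mxE scalerBl rowK.
rewrite (eqP (valP (La c))) dim_span_row_free //.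
by rewrite /row_free mxrankMfree ?row_free_unit //; apply: normal_form_free.
Qed.

(* All configurations in general position form one orbit of GL_{n+1}, which
   contains a configuration of secant spaces of the standard curve. *)
Lemma feasible_normal_form :
  (forall La : configuration K L, general_position La ->
    exists es, adapted La es) ->
  feasible K L.
Proof.
move=> adaptable.
have [La0 [t [gp0 t_inj La0E]]] := general_position_secant K L.
exists (@general_position K n L); split.
- exact: zariski_open_general_position.
- by exists La0.
have [es0 /adaptedE[E0 E0U E0E]] := adaptable _ gp0.
move=> La gp; have [es /adaptedE[E EU EE]] := adaptable _ gp.
(* [h] carries one adapted basis to the other, hence [La0] to [La], and the standard curve to a
   curve for which the components of [La] are secant spaces. *)
pose h := invmx E0 *m E.
have hU : h \in unitmx by rewrite unitmx_mul unitmx_inv E0U.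
exists (curve h); first by exists h.
move=> c; have lt_c := component_dim_lt c.
have le_c : ((component_dim c).+1 <= n)%N by lia.
suff -> : linear_cone (La c) = [set v | v \in
    <<[seq veronese n 1 (t c j) *m h | j : 'I_(component_dim c).+1]>>%VS]%classic.
  exact: intersection_degree_secant.
rewrite /linear_cone EE; apply/seteqP.
pose Y := \matrix_i veronese n 1 (t c i).
have -> : [seq veronese n 1 (t c j) *m h | j : 'I_(component_dim c).+1] =
    [seq row j (Y *m h) | j : 'I_(component_dim c).+1].
  by apply: eq_map => j; rewrite row_mul rowK.
have YE : (Y :=: normal_form c *m E0)%MS.
  apply/eqmxP/andP; split; apply/row_subP => i.
    by rewrite -mem_span_rows -E0E La0E mem_span_rows row_sub.
  by rewrite -mem_span_rows -La0E E0E mem_span_rows row_sub.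
have hE : (Y *m h :=: normal_form c *m E)%MS.
  have -> : normal_form c *m E = normal_form c *m E0 *m h.
    by rewrite /h mulmxA mulmxK.
  exact: eqmxMr.
by split=> v /=; rewrite !mem_span_rows hE.
Qed.

End NormalForm.


(** * Bases adapted to general subspaces of P^3, P^4 and P^5 *)

Section AdaptedBases.
Variables (F : fieldType) (vT : vectType F).
Implicit Types (U V W : {vspace vT}) (X : seq vT).

Lemma cap_dim_eq0 U V x : (\dim U + \dim V <= \dim (U + V)%VS)%N ->
  x \in U -> x \in V -> x = 0.
Proof.
move=> dimUV xU xV; suff cap0 : (U :&: V == 0)%VS.
  by apply/eqP; rewrite -memv0 -(eqP cap0) memv_cap xU.
by rewrite -dimv_eq0; have := dimv_sum_cap U V; lia.
Qed.

Lemma span_completion V x : x \in V -> x != 0 ->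
  exists2 X, size X = (\dim V).-1 & <<x :: X>>%VS = V.
Proof.
move=> xV x0; have sub : (<[x]> <= V)%VS by rewrite -memvE.
exists (vbasis (V :\: <[x]>)%VS).
  rewrite size_tuple; have := dimv_cap_compl V <[x]>.
  by move/capv_idPr: sub => ->; rewrite dim_vline x0; lia.
rewrite span_cons (span_basis (vbasisP _)) addvC addv_diff.
exact/addv_idPl.
Qed.

Lemma free_dim_span X : (size X <= \dim <<X>>)%N -> free X.
Proof. by move=> leX; rewrite /free eqn_leq dim_span. Qed.

Lemma addv_full_mem U V x : (\dim {:vT} <= \dim (U + V)%VS)%N ->
  exists2 u, u \in U & u - x \in V.
Proof.
move=> full; have : x \in (U + V)%VS.
  suff /eqP-> : (U + V)%VS == fullv by rewrite memvf.
  by rewrite eqEdim subvf.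
case/memv_addP => u uU [v vV ->]; exists u => //.
by rewrite opprD addrA subrr add0r memvN.
Qed.

Lemma vpick_dim_gt0 V : (0 < \dim V)%N -> exists2 x, x \in V & x != 0.
Proof.
by rewrite lt0n dimv_eq0 => V0; exists (vpick V); rewrite ?memv_pick ?vpick0.
Qed.

Lemma adapted_basis_P3 (p l : {vspace vT}) :
  \dim {:vT} = 4 -> \dim p = 1 -> \dim l = 2 -> (3 <= \dim (p + l)%VS)%N ->
  exists e0 e1 e2 e3, [/\ free [:: e0; e1; e2; e3], e1 \in p &
    e2 \in l /\ e3 \in l].
Proof.
move=> dimT dimp diml pl.
have [|e1 e1p e10] := @vpick_dim_gt0 p; first by rewrite dimp.
have [|e2 e2l e20] := @vpick_dim_gt0 l; first by rewrite diml.
have [[|? []] //] := span_completion e1p e10; rewrite dimp // => _ pE.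
have [[|e3 []] //] := span_completion e2l e20; rewrite diml // => _ lE.
have [|e0 e0C e00] := @vpick_dim_gt0 ((p + l)^C)%VS.
  rewrite dimv_compl dimT; have := (dimv_add_leqif p l).1.
  by rewrite dimp diml; lia.
exists e0, e1, e2, e3; split=> //.
  have spanE : <<[:: e1; e2; e3]>>%VS = (p + l)%VS.
    by rewrite -[_ :: _]/([:: e1] ++ [:: e2; e3]) span_cat pE lE.
  rewrite free_cons spanE; apply/andP; split.
    apply: contra e00 => e0pl; rewrite -memv0 -(capv_compl (p + l)).
    by rewrite memv_cap e0pl.
  by apply: free_dim_span; rewrite spanE.
by rewrite -lE; split; apply: memv_span; rewrite !inE eqxx ?orbT.
Qed.

(** Here [l] and [pi] are complementary, so a generator of [p] decomposes as [e0 - e2]. Both terms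
    are non-zero since [p] lies in neither space, and each is completed to a basis of its space. *)
Lemma adapted_basis_P4 (p l pi : {vspace vT}) :
  \dim {:vT} = 5 -> \dim p = 1 -> \dim l = 2 -> \dim pi = 3 ->
  (5 <= \dim (l + pi)%VS)%N -> (3 <= \dim (p + l)%VS)%N ->
  (4 <= \dim (p + pi)%VS)%N ->
  exists e0 e1 e2 e3 e4, [/\ free [:: e0; e1; e2; e3; e4], e0 - e2 \in p,
    e0 \in l /\ e1 \in l & [/\ e2 \in pi, e3 \in pi & e4 \in pi]].
Proof.
move=> dimT dimp diml dimpi lpi pl ppi.
have [|x xp x0] := @vpick_dim_gt0 p; first by rewrite dimp.
have [|e0 e0l e0x] := @addv_full_mem l pi x; first by rewrite dimT.
pose e2 := e0 - x.
have e00 : e0 != 0.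
  apply: contraNneq x0 => e00; apply/eqP/(@cap_dim_eq0 p pi) => //.
    by rewrite dimp dimpi.
  by move: e0x; rewrite e00 sub0r memvN.
have e20 : e2 != 0.
  apply: contraNneq x0 => /eqP; rewrite subr_eq0 => /eqP e0x0.
  by apply/eqP/(@cap_dim_eq0 p l); rewrite -?e0x0 ?dimp ?diml // e0x0.
have [[|e1 []] //] := span_completion e0l e00; rewrite diml // => _ lE.
have [[|e3 [|e4 []]] //] := span_completion e0x e20; rewrite dimpi // => _ piE.
exists e0, e1, e2, e3, e4; split.
- apply: free_dim_span; rewrite -[_ :: _]/([:: e0; e1] ++ [:: e2; e3; e4]).
  by rewrite span_cat lE piE.
- by rewrite /e2 opprB addrC subrK.
- by rewrite -lE; split; apply: memv_span; rewrite !inE eqxx ?orbT.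
- by rewrite -piE; split; apply: memv_span; rewrite !inE eqxx ?orbT.
Qed.

(** Modulo [sg], the generator [e0] of [p] agrees with some [e1] in [l], completed by [e2]. Then
    [e3] and [e4] in [pi] lift the classes of [e1] and [e2], and [e5] is a non-zero vector of the
    intersection of [pi] and [sg]. *)
Lemma adapted_basis_P5 (p l pi sg : {vspace vT}) :
  \dim {:vT} = 6 -> \dim p = 1 -> \dim l = 2 -> \dim pi = 3 -> \dim sg = 4 ->
  (6 <= \dim (p + (l + pi))%VS)%N -> (5 <= \dim (p + sg)%VS)%N ->
  (6 <= \dim (l + sg)%VS)%N -> (6 <= \dim (pi + sg)%VS)%N ->
  exists e0 e1 e2 e3 e4 e5, [/\ free [:: e0; e1; e2; e3; e4; e5], e0 \in p,
    e1 \in l /\ e2 \in l, [/\ e3 \in pi, e4 \in pi & e5 \in pi] &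
    [/\ e0 - e1 \in sg, e3 - e1 \in sg, e4 - e2 \in sg & e5 \in sg]].
Proof.
move=> dimT dimp diml dimpi dimsg plpi psg lsg pisg.
have l_sg x : x \in l -> x \in sg -> x = 0.
  by apply: cap_dim_eq0; rewrite diml dimsg.
have [|e0 e0p e00] := @vpick_dim_gt0 p; first by rewrite dimp.
have [|e1 e1l e10s] := @addv_full_mem l sg e0; first by rewrite dimT.
have e01s : e0 - e1 \in sg by rewrite -opprB memvN.
have e10 : e1 != 0.
  apply: contraNneq e00 => e10; apply/eqP/(@cap_dim_eq0 p sg) => //.
    by rewrite dimp dimsg.
  by move: e01s; rewrite e10 subr0.
have [[|e2 []] //] := span_completion e1l e10; rewrite diml // => _ lE.
have e2l : e2 \in l by rewrite -lE memv_span // !inE eqxx orbT.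
have free12 : free [:: e1; e2] by rewrite /free lE diml.
have [|e3 e3pi e31s] := @addv_full_mem pi sg e1; first by rewrite dimT.
have [|e4 e4pi e42s] := @addv_full_mem pi sg e2; first by rewrite dimT.
have [|e5] := @vpick_dim_gt0 (pi :&: sg)%VS.
  have := dimv_sum_cap pi sg; have := dimvS (subvf (pi + sg)%VS).
  by rewrite dimT dimpi dimsg; lia.
rewrite memv_cap => /andP[e5pi e5s] e50.
(* Modulo [sg], [e3] and [e4] are [e1] and [e2], independent since [l] meets
   [sg] trivially. *)
have free345 : free [:: e3; e4; e5].
  move: free12; rewrite !free_cons nil_free !span_cons span_nil !addv0.
  rewrite memv0 !andbT => /andP[e1e2 e20]; rewrite memv0 e50 andbT.
  apply/andP; split; last first.
    apply: contra e20 => /vlineP[b e4E]; apply/eqP/l_sg => //.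
    by rewrite -(subKr e4 e2) memvB // e4E memvZ.
  apply: contra e1e2 => /memv_addP[_ /vlineP[a ->] [_ /vlineP[b ->] e3E]].
  apply/vlineP; exists a; apply/eqP; rewrite -subr_eq0; apply/eqP/l_sg.
    by rewrite memvB ?memvZ.
  have -> : e1 - a *: e2 = (e1 - e3) + (e3 - a *: e4) + a *: (e4 - e2).
    by rewrite scalerBr !addrA !subrK.
  apply: memvD; last exact: memvZ.
  apply: memvD; first by rewrite -opprB memvN.
  by rewrite e3E addrC addKr memvZ.
have piE : <<[:: e3; e4; e5]>>%VS = pi.
  apply/eqP; rewrite eqEdim dimpi (eqP free345) andbT.
  by apply/span_subvP => x; rewrite !inE => /or3P[] /eqP ->.
have pE : <[e0]>%VS = p.
  by apply/eqP; rewrite eqEdim dimp dim_vline e00 -memvE e0p.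
exists e0, e1, e2, e3, e4, e5; split=> //.
apply: free_dim_span.
rewrite -[_ :: _]/([:: e0] ++ [:: e1; e2] ++ [:: e3; e4; e5]).
by rewrite !span_cat span_seq1 lE piE pE.
Qed.

End AdaptedBases.

(** * Feasibility for n from 2 to 5 *)

Section FeasibleOnes.
Variable K : closedFieldType.

Section Components.
Variable n : nat.
Local Notation ones := (fun _ : 'I_n.-1 => 1%N).
Local Notation component := (component ones).

Definition ones_component d (lt_d : (d < n.-1)%N) : component :=
  existT (fun _ => 'I_1) (Ordinal lt_d) ord0.

Lemma component_dim_inj : injective (@component_dim n ones).
Proof.
move=> [d1 j1] [d2 j2] /val_inj /= d12; rewrite d12 in j1 *.
by rewrite (ord1 j1) (ord1 j2).
Qed.

Lemma general_position2 (La : configuration K ones) c1 c2 :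
  general_position La -> (component_dim c1 != component_dim c2)%N ->
  (minn n.+1 ((component_dim c1).+1 + (component_dim c2).+1) <=
    \dim (val (La c1) + val (La c2))%VS)%N.
Proof.
move=> gp neq12; have := gp [set c1; c2]; rewrite /expected_dim.
have c12 : c1 \notin [set c2] by rewrite inE -(inj_eq component_dim_inj).
by rewrite !big_setU1 // !big_set1.
Qed.

Lemma general_position3 (La : configuration K ones) c1 c2 c3 :
  general_position La -> uniq [:: component_dim c1; component_dim c2;
    component_dim c3] ->
  (minn n.+1 ((component_dim c1).+1 +
      ((component_dim c2).+1 + (component_dim c3).+1)) <=
    \dim (val (La c1) + (val (La c2) + val (La c3)))%VS)%N.
Proof.
move=> gp; rewrite /= !inE !(inj_eq component_dim_inj) negb_or !andbT.
move=> /andP[/andP[neq12 neq13] neq23].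
have := gp (c1 |: [set c2; c3]); rewrite /expected_dim.
have c123 : c1 \notin [set c2; c3] by rewrite !inE negb_or neq12.
have c23 : c2 \notin [set c3] by rewrite inE.
by rewrite !big_setU1 // !big_set1.
Qed.

End Components.

Lemma dim_linear_space n k (V : linear_space K n k) : \dim (val V) = k.+1.
Proof. exact/eqP/(valP V). Qed.

Lemma feasible_ones2 : @feasible K 2 (fun=> 1%N).
Proof.
apply: (@feasible_normal_form K 2 _ [:: [:: 0]] [::])%N => // La gp.
pose c0 : component _ := @ones_component 2 0 isT.
have dim0 : \dim (val (La c0)) = 1 by apply: dim_linear_space.
have [|x x0 xn0] := @vpick_dim_gt0 _ _ (val (La c0)); first by rewrite dim0.
have [X sX XE] := span_completion (memvf x) xn0.
have dimT : \dim {: 'rV[K]_3} = 3 by rewrite dimvf.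
exists (x :: X); split.
- by rewrite /= sX dimT.
- by apply: free_dim_span; rewrite XE /= sX dimT.
move=> c i; have -> : c = c0.
  apply: component_dim_inj; have := component_dim_lt c.
  by case: (component_dim c).
by case: i => //= _; rewrite nth_default ?subr0 //= sX dimT.
Qed.

Lemma feasible_ones3 : @feasible K 3 (fun=> 1%N).
Proof.
apply: (@feasible_normal_form K 3 _ [:: [:: 1]; [:: 2; 3]] [::])%N => // La gp.
pose c0 : component _ := @ones_component 3 0 isT.
pose c1 : component _ := @ones_component 3 1 isT.
have dim0 : \dim (val (La c0)) = 1 by apply: dim_linear_space.
have dim1 : \dim (val (La c1)) = 2 by apply: dim_linear_space.
have dimT : \dim {: 'rV[K]_4} = 4 by rewrite dimvf.
have [e0 [e1 [e2 [e3 [fes e1p [e2l e3l]]]]]] := adapted_basis_P3 dimT dim0 dim1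
  (@general_position2 3 La c0 c1 gp isT).
exists [:: e0; e1; e2; e3]; split=> // c i.
have [->|->] : c = c0 \/ c = c1.
- have := component_dim_lt c; case dimc: (component_dim c) => [|[|]] // _;
    [left|right]; exact: component_dim_inj.
- by case: i => //= _; rewrite subr0.
by case: i => [|[|]] //= _; rewrite subr0.
Qed.

Lemma feasible_ones4 : @feasible K 4 (fun=> 1%N).
Proof.
(* The point is spanned by [e0 - e2], the line by [e0, e1], the plane by [e2, e3, e4]. *)
apply: (@feasible_normal_form K 4 _
  [:: [:: 0]; [:: 0; 1]; [:: 2; 3; 4]] [:: [:: 2]])%N => // La gp.
pose c0 : component _ := @ones_component 4 0 isT.
pose c1 : component _ := @ones_component 4 1 isT.
pose c2 : component _ := @ones_component 4 2 isT.
have dim0 : \dim (val (La c0)) = 1 by apply: dim_linear_space.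
have dim1 : \dim (val (La c1)) = 2 by apply: dim_linear_space.
have dim2 : \dim (val (La c2)) = 3 by apply: dim_linear_space.
have dimT : \dim {: 'rV[K]_5} = 5 by rewrite dimvf.
have [e0 [e1 [e2 [e3 [e4 [fes e02p [e0l e1l] [e2pi e3pi e4pi]]]]]]] :=
  adapted_basis_P4 dimT dim0 dim1 dim2
  (@general_position2 4 La c1 c2 gp isT) (@general_position2 4 La c0 c1 gp isT)
  (@general_position2 4 La c0 c2 gp isT).
exists [:: e0; e1; e2; e3; e4]; split=> // c i.
have [->|->|->] : [\/ c = c0, c = c1 | c = c2].
- have := component_dim_lt c; case dimc: (component_dim c) => [|[|[|]]] // _;
    [apply: Or31|apply: Or32|apply: Or33]; exact: component_dim_inj.
- by case: i.
- by case: i => [|[|]] //= _; rewrite subr0.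
by case: i => [|[|[|]]] //= _; rewrite subr0.
Qed.

Lemma feasible_ones5 : @feasible K 5 (fun=> 1%N).
Proof.
(* The last rows of the tables encode the span of [e0 - e1, e3 - e1, e4 - e2, e5]; the missing
   fourth entry of the second table means that nothing is subtracted from [e5]. *)
apply: (@feasible_normal_form K 5 _
  [:: [:: 0]; [:: 1; 2]; [:: 3; 4; 5]; [:: 0; 3; 4; 5]]
  [:: [::]; [::]; [::]; [:: 1; 1; 2]])%N => // La gp.
pose c0 : component _ := @ones_component 5 0 isT.
pose c1 : component _ := @ones_component 5 1 isT.
pose c2 : component _ := @ones_component 5 2 isT.
pose c3 : component _ := @ones_component 5 3 isT.
have dim0 : \dim (val (La c0)) = 1 by apply: dim_linear_space.
have dim1 : \dim (val (La c1)) = 2 by apply: dim_linear_space.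
have dim2 : \dim (val (La c2)) = 3 by apply: dim_linear_space.
have dim3 : \dim (val (La c3)) = 4 by apply: dim_linear_space.
have dimT : \dim {: 'rV[K]_6} = 6 by rewrite dimvf.
have [e0 [e1 [e2 [e3 [e4 [e5 [fes e0p [e1l e2l] [e3pi e4pi e5pi]
    [e01 e31 e42 e5s]]]]]]]] := adapted_basis_P5 dimT dim0 dim1 dim2 dim3
  (@general_position3 5 La c0 c1 c2 gp isT)
  (@general_position2 5 La c0 c3 gp isT) (@general_position2 5 La c1 c3 gp isT)
  (@general_position2 5 La c2 c3 gp isT).
exists [:: e0; e1; e2; e3; e4; e5]; split=> // c i.
have [->|->|->|->] : [\/ c = c0, c = c1, c = c2 | c = c3].
- have := component_dim_lt c; case dimc: (component_dim c) => [|[|[|[|]]]] // _;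
    [apply: Or41|apply: Or42|apply: Or43|apply: Or44]; exact: component_dim_inj.
- by case: i => //= _; rewrite subr0.
- by case: i => [|[|]] //= _; rewrite subr0.
- by case: i => [|[|[|]]] //= _; rewrite subr0.
by case: i => [|[|[|[|]]]] //= _; rewrite subr0.
Qed.

End FeasibleOnes.

Theorem proposition5p3 (R : realType) (n : nat) (hn : (2 <= n)%N) :
  let L : weight_vector n := fun _ => 1%N in
  ((n <= 5)%N -> feasible R[i] L) /\ ((8 <= n)%N -> non_feasible R[i] L).
Proof.
cbv zeta; split; last exact: non_feasible_ones.
case: n hn => [|[|[|[|[|[|]]]]]] // _ _.
- exact: feasible_ones2.
- exact: feasible_ones3.
- exact: feasible_ones4.
- exact: feasible_ones5.
Qed.
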